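(* Let $G$ be a group, let $B=\bigoplus_{t\in G}B_t$ be a partially-strongly-graded algebra and let $I^B$ be its partial smash product. Then $B$ is strongly-graded-equivalent to the partial skew group algebra $I^B\rtimes_{\gamma^B}G$.
   Context: Algebras are associative, not necessarily unital, over a fixed commutative associative unital ring $k$; $G$ is an arbitrary group. Products of subsets such as $UV$ denote the $k$-span of all products $uv$. An algebra $A$ is idempotent if $A^2=A$. A $G$-graded algebra $B=\bigoplus_tB_t$ ($B_sB_t\subseteq B_{st}$) is partially-strongly-graded if $B_t=B_tB_{t^{-1}}B_t$ for all $t\in G$. A bimodule ${}_RM_S$ is unital if $RM=M=MS$. Smash product: $B\#G:=\bigoplus_{r,s\in G}B_{r^{-1}s}e_{r,s}$, a subalgebra of the algebra of $G\times G$-matrices over $B$ with finitely many nonzero entries ($b\,e_{r,s}$ has $b$ at position $(r,s)$ and $0$ elsewhere). The action $\beta^B$ of $G$ on $B\#G$ is $\beta^B_t(b\,e_{r,s})=b\,e_{tr,ts}$. The partial smash product is the two-sided ideal $I^B:=\bigoplus_{r,s\in G}B_{r^{-1}}B_se_{r,s}$ of $B\#G$. For $B$ partially-strongly-graded, $I:=I^B$ is idempotent and $I\beta^B_t(I)=\beta^B_t(I)I$ for all $t$; the canonical partial action $\gamma^B$ of $G$ on $I^B$ has domains $I_t:=I\beta^B_t(I)$ and isomorphisms $\gamma^B_t:=\beta^B_t|_{I_{t^{-1}}}:I_{t^{-1}}\to I_t$. Its skew group algebra is $I^B\rtimes_{\gamma^B}G=\bigoplus_tI_t\delta_t$ with $(a\delta_r)(b\delta_s)=\gamma^B_r((\gamma^B_r)^{-1}(a)b)\delta_{rs}$,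 $G$-graded with $I_t\delta_t$ in degree $t$. For a graded algebra $A$ put $D^A_t:=A_tA_{t^{-1}}$, a two-sided ideal of $A_1$. A Morita context $(A,B,X,Y,\tau_A,\tau_B)$ consists of algebras $A,B$, an $(A,B)$-bimodule $X$, a $(B,A)$-bimodule $Y$, an $A$-bimodule map $\tau_A:X\otimes_BY\to A$ and a $B$-bimodule map $\tau_B:Y\otimes_AX\to B$ with $\tau_A(x\otimes y)x'=x\tau_B(y\otimes x')$ and $\tau_B(y\otimes x)y'=y\tau_A(x\otimes y')$. It is a graded Morita context between idempotent $G$-graded algebras $A,B$ if $X=\bigoplus_tX_t$, $Y=\bigoplus_tY_t$ are $G$-graded bimodules, and $\tau_A(X_r\otimes_B Y_s)\subseteq A_{rs}$, $\tau_B(Y_r\otimes_A X_s)\subseteq B_{rs}$ for all $r,s\in G$. Suppose all $D^A_t$, $D^B_t$ are idempotent. A graded Morita context is strong if each $X_t$ is a unital $(D^A_t,D^B_{t^{-1}})$-bimodule and each $Y_t$ is a unital $(D^B_t,D^A_{t^{-1}})$-bimodule. The idempotent graded algebras $A$ and $B$ are strongly-graded-equivalent if there is a strong graded Morita context with $\tau_A,\tau_B$ surjective such that, for all $t\in G$, the $k$-span of $\{\tau_A(x\otimes y):x\in X_t,y\in Y_{t^{-1}}\}$ is $D^A_t$ and the $k$-span of $\{\tau_B(y\otimes x):y\in Y_t,x\in X_{t^{-1}}\}$ is $D^B_t$. *)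

(* Defs.v *)
From HB Require Import structures.
From mathcomp Require Import all_boot all_algebra generic_quotient ring_quotient.
From mathcomp Require Import boolp classical_sets functions cardinality fsbigop.

Set Implicit Arguments.
Unset Strict Implicit.
Unset Printing Implicit Defensive.

Import GRing.Theory.

Local Open Scope classical_set_scope.
Local Open Scope ring_scope.
Local Open Scope quotient_scope.

Declare Scope nualg_scope.
Open Scope nualg_scope.

Section Linear.
Variables (k : pzRingType) (V : lmodType k).

Definition linear_set (S : set V) : Prop :=
  S 0 /\ forall (c : k) x y, S x -> S y -> S (c *: x + y).

Definition kspan (S : set V) : set V :=
  [set v | exists (n : nat) (c : 'I_n -> k) (s : 'I_n -> V),
     (forall i, S (s i)) /\ v = \sum_(i < n) c i *: s i].

Definition fin_supp (T : Type) (f : T -> V) : Prop :=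
  finite_set [set t | f t != 0].

Definition direct_sum (I : choiceType) (W : I -> set V) : Prop :=
  (forall i, linear_set (W i)) /\
  (forall v, exists! f : I -> V,
     [/\ fin_supp f, forall i, W i (f i) & v = \sum_(i \in [set: I]) f i]).

Lemma linear_set_sum (S : set V) (I : Type) (r : seq I) (P : pred I)
    (F : I -> V) :
  linear_set S -> (forall i, P i -> S (F i)) -> S (\sum_(i <- r | P i) F i).
Proof.
move=> [S0 Sl] SF; elim/big_rec: _ => [|i x /SF Pi Sx]; first exact: S0.
by rewrite -[F i]scale1r; apply: Sl.
Qed.

Lemma linear_setZ (S : set V) c x : linear_set S -> S x -> S (c *: x).
Proof. by move=> [S0 Sl] Sx; rewrite -[_ *: _]addr0; apply: Sl. Qed.

Lemma linear_fsum (S : set V) (I : choiceType) (F : I -> V) :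
  linear_set S -> (forall i, S (F i)) -> S (\sum_(i \in [set: I]) F i).
Proof. by move=> lS SF; apply: linear_set_sum. Qed.

Lemma kspan_sub (S T : set V) : linear_set T -> S `<=` T -> kspan S `<=` T.
Proof.
move=> lT ST v [n [c [s [Ss ->]]]]; apply: linear_set_sum => // i _.
by apply: linear_setZ => //; apply: ST.
Qed.

Lemma kspanS (S : set V) : S `<=` kspan S.
Proof.
move=> x Sx; exists 1%N, (fun=> 1), (fun=> x).
by split=> //; rewrite big_ord_recl big_ord0 addr0 scale1r.
Qed.

Lemma kspan_linear (S : set V) : linear_set (kspan S).
Proof.
split; first by exists 0%N, (fun=> 0), (fun=> 0); split; [case|rewrite big_ord0].
move=> a _ _ [n [c [s [Ss ->]]]] [m [d [u [Su ->]]]].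
exists (n + m)%N.
exists (fun i : 'I_(n + m) =>
  match fintype.split i with inl j => a * c j | inr j => d j end).
exists (fun i : 'I_(n + m) =>
  match fintype.split i with inl j => s j | inr j => u j end).
split; first by move=> i; case: fintype.split.
rewrite big_split_ord /= scaler_sumr; congr (_ + _); apply: eq_bigr => i _.
  by rewrite (unsplitK (inl i)) scalerA.
by rewrite (unsplitK (inr i)).
Qed.

Lemma fin_supp0 (T : Type) : fin_supp (0 : T -> V).
Proof.
by rewrite /fin_supp (_ : [set _ | _] = set0) // -subset0 => t; rewrite /= eqxx.
Qed.

Lemma fin_suppD (T : Type) c (f g : T -> V) :
  fin_supp f -> fin_supp g -> fin_supp (c *: f + g).
Proof.
move=> ff fg; have: finite_set ([set t | f t != 0] `|` [set t | g t != 0]).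
  by rewrite finite_setU.
apply: sub_finite_set => t /= h; apply/orP; move: h; apply: contraNT.
by rewrite negb_or !negbK => /andP[/eqP ft /eqP gt];
   rewrite !fctE ft gt scaler0 addr0.
Qed.

Lemma fin_supp_seq (T : choiceType) (f : T -> V) : fin_supp f ->
  exists s : seq T, uniq s /\ forall t, t \notin s -> f t = 0.
Proof.
move=> /finite_seqP[s es]; exists (undup s); split; first exact: undup_uniq.
move=> t; rewrite mem_undup => ts; apply/eqP; apply: contraNT ts => ft.
by have : [set` s] t by rewrite -es.
Qed.

Lemma fsum_seq (T : choiceType) (F : T -> V) (s : seq T) : uniq s ->
  (forall t, t \notin s -> F t = 0) ->
  \sum_(t \in [set: T]) F t = \sum_(t <- s) F t.
Proof.
move=> us Fs; rewrite (fsbigE s) // => [|i _ /Fs] //.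
by apply: eq_bigl => i; rewrite in_setT.
Qed.

End Linear.

HB.mixin Record Lmodule_isNUAlgebra (k : comPzRingType) A
    of GRing.Lmodule k A := {
  amul : A -> A -> A;
  amulA : associative amul;
  amulDl : left_distributive amul +%R;
  amulDr : right_distributive amul +%R;
  amulZl : forall (c : k) (x y : A), amul (c *: x) y = c *: amul x y;
  amulZr : forall (c : k) (x y : A), amul x (c *: y) = c *: amul x y
}.

#[short(type="nuAlgType")]
HB.structure Definition NUAlgebra (k : comPzRingType) :=
  {A of Lmodule_isNUAlgebra k A & GRing.Lmodule k A}.

Notation "x ** y" := (amul x y) (at level 40, left associativity)
  : nualg_scope.

Section NUAlgebraTheory.
Variables (k : comPzRingType) (A : nuAlgType k).
Implicit Types (x y : A) (U V : set A).

Definition mulset U V : set A := kspan [set x ** y | x in U & y in V].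

Definition idempotent_set U : Prop := mulset U U = U.

Lemma amul0l x : 0 ** x = 0.
Proof. by have := amulZl 0 0 x; rewrite !scale0r. Qed.

Lemma amul0r x : x ** 0 = 0.
Proof. by have := amulZr 0 x 0; rewrite !scale0r. Qed.

Lemma amul_suml (I : Type) (r : seq I) (F : I -> A) x :
  (\sum_(i <- r) F i) ** x = \sum_(i <- r) F i ** x.
Proof.
by elim: r => [|i r IH]; rewrite ?big_nil ?amul0l // !big_cons amulDl IH.
Qed.

Lemma amul_sumr (I : Type) (r : seq I) (F : I -> A) x :
  x ** (\sum_(i <- r) F i) = \sum_(i <- r) x ** F i.
Proof.
by elim: r => [|i r IH]; rewrite ?big_nil ?amul0r // !big_cons amulDr IH.
Qed.

Lemma mulset_linear U V : linear_set (mulset U V).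
Proof. exact: kspan_linear. Qed.

Lemma mem_mulset U V x y : U x -> V y -> mulset U V (x ** y).
Proof. by move=> Ux Vy; apply: kspanS; exists x => //; exists y. Qed.

Lemma mulset_sub U V (T : set A) : linear_set T ->
  (forall x y, U x -> V y -> T (x ** y)) -> mulset U V `<=` T.
Proof.
by move=> lT UVT; apply: kspan_sub => // _ [x Ux [y Vy <-]]; apply: UVT.
Qed.

End NUAlgebraTheory.

Notation "U `** V" := (mulset U V) (at level 40, left associativity)
  : nualg_scope.

HB.mixin Record NUAlgebra_isGraded (k : comPzRingType) (G : groupType) A
    of NUAlgebra k A := {
  homog : G -> set A;
  homog_direct : direct_sum homog;
  homogM : forall s t x y, homog s x -> homog t y -> homog (s * t)%g (amul x y)
}.

#[short(type="gradedAlgType")]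
HB.structure Definition GradedAlgebra (k : comPzRingType) (G : groupType) :=
  {A of NUAlgebra_isGraded k G A & NUAlgebra k A}.

Arguments homog {k G} s _.

Definition partially_strongly_graded (k : comPzRingType) (G : groupType)
    (B : gradedAlgType k G) : Prop :=
  forall t : G, homog B t = homog B t `** homog B t^-1%g `** homog B t.

Definition Dideal (k : comPzRingType) (G : groupType) (A : gradedAlgType k G)
    (t : G) : set A :=
  homog A t `** homog A t^-1%g.
Arguments Dideal {k G} A t.

HB.mixin Record Lmodule_isBimodule (k : comPzRingType) (R S : nuAlgType k) X
    of GRing.Lmodule k X := {
  lact : R -> X -> X;
  ract : X -> S -> X;
  lactDl : forall (a b : R) (x : X), lact (a + b) x = lact a x + lact b x;
  lactDr : forall (a : R) (x y : X), lact a (x + y) = lact a x + lact a y;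
  lactZl : forall (c : k) (a : R) (x : X), lact (c *: a) x = c *: lact a x;
  lactZr : forall (c : k) (a : R) (x : X), lact a (c *: x) = c *: lact a x;
  lactM : forall (a b : R) (x : X), lact (a ** b) x = lact a (lact b x);
  ractDl : forall (x y : X) (b : S), ract (x + y) b = ract x b + ract y b;
  ractDr : forall (x : X) (a b : S), ract x (a + b) = ract x a + ract x b;
  ractZl : forall (c : k) (x : X) (b : S), ract (c *: x) b = c *: ract x b;
  ractZr : forall (c : k) (x : X) (b : S), ract x (c *: b) = c *: ract x b;
  ractM : forall (x : X) (a b : S), ract x (a ** b) = ract (ract x a) b;
  lractA : forall (a : R) (x : X) (b : S), ract (lact a x) b = lact a (ract x b)
}.

#[short(type="bimodType")]
HB.structure Definition Bimodule (k : comPzRingType) (R S : nuAlgType k) :=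
  {X of Lmodule_isBimodule k R S X & GRing.Lmodule k X}.

Notation "a *> x" := (lact a x) (at level 40, left associativity)
  : nualg_scope.
Notation "x <* b" := (ract x b) (at level 40, left associativity)
  : nualg_scope.

Definition unital_for (k : comPzRingType) (R S : nuAlgType k)
    (X : bimodType R S) (D : set R) (W : set X) (E : set S) : Prop :=
  kspan [set a *> x | a in D & x in W] = W /\
  kspan [set x <* b | x in W & b in E] = W.

Definition graded_bimodule (k : comPzRingType) (G : groupType)
    (R S : gradedAlgType k G) (X : bimodType R S) (X_ : G -> set X) : Prop :=
  [/\ direct_sum X_,
      forall s t (a : R) x, homog R s a -> X_ t x -> X_ (s * t)%g (a *> x) &
      forall s t x (b : S), X_ s x -> homog S t b -> X_ (s * t)%g (x <* b)].

Section FreeModule.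
Variables (k : comPzRingType) (T : choiceType).

Definition free_pred : {pred T -> k^o} := fun f => `[< fin_supp f >].

Lemma free_pred_submod : submod_closed free_pred.
Proof.
split=> [|c f g /asboolP ff /asboolP fg]; apply/asboolP; first exact: fin_supp0.
exact: fin_suppD.
Qed.

HB.instance Definition _ :=
  GRing.isSubmodClosed.Build k (T -> k^o) free_pred free_pred_submod.

Record freemod :=
  FreeMod { freemod_fun :> T -> k^o; _ : freemod_fun \in free_pred }.

HB.instance Definition _ := [isSub for freemod_fun].
HB.instance Definition _ := [Choice of freemod by <:].
HB.instance Definition _ := [SubChoice_isSubLmodule of freemod by <:].

Definition delta_fun (t : T) : T -> k^o := fun u => (u == t)%:R.

Lemma delta_subproof t : delta_fun t \in free_pred.
Proof.
apply/asboolP; apply: (sub_finite_set _ (finite_set1 t)) => u /=.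
by rewrite /delta_fun; case: (eqVneq u t) => // _; rewrite eqxx.
Qed.

Definition delta t : freemod := FreeMod (delta_subproof t).

End FreeModule.

Section QuotientModule.
Variables (k : pzRingType) (V : lmodType k) (N : set V).

Definition lquot_pred (_ : linear_set N) : {pred V} := fun v => `[< N v >].

Variable N_linear : linear_set N.

Lemma lquot_pred_zmod : zmod_closed (lquot_pred N_linear).
Proof.
split=> [|v w /asboolP Nv /asboolP Nw]; apply/asboolP; first exact: N_linear.1.
by rewrite addrC -scaleN1r; apply: N_linear.2.
Qed.

HB.instance Definition _ :=
  GRing.isZmodClosed.Build V (lquot_pred N_linear) lquot_pred_zmod.

Definition lquot := Quotient.quot (lquot_pred N_linear).
HB.instance Definition _ := GRing.Zmodule.on lquot.

Definition lclass (v : V) : lquot :=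
  \pi_(Quotient.quot (lquot_pred N_linear)) v.
Definition lrepr (z : lquot) : V :=
  repr (z : Quotient.quot (lquot_pred N_linear)).

Lemma lreprK z : lclass (lrepr z) = z.
Proof. by rewrite /lclass reprK. Qed.

Lemma lclass_eq v w : lclass v = lclass w <-> N (v - w).
Proof.
have e : (lclass v == lclass w) = (v - w \in lquot_pred N_linear).
  by rewrite Quotient.idealrBE.
by split=> [/eqP|h]; [rewrite e => /asboolP | apply/eqP; rewrite e; apply/asboolP].
Qed.

Lemma lclassD v w : lclass (v + w) = lclass v + lclass w.
Proof. exact: Quotient.pi_add. Qed.

Definition lquot_scale (c : k) (z : lquot) : lquot := lclass (c *: lrepr z).

Lemma lclassZ_subproof c v : lclass (c *: v) = lquot_scale c (lclass v).
Proof.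
apply/lclass_eq; rewrite -scalerBr; apply: linear_setZ => //.
by apply/lclass_eq; rewrite lreprK.
Qed.

Lemma lquot_scaleA a b z :
  lquot_scale a (lquot_scale b z) = lquot_scale (a * b) z.
Proof. by rewrite -[z]lreprK -!lclassZ_subproof scalerA. Qed.

Lemma lquot_scale1 : left_id 1 lquot_scale.
Proof. by move=> z; rewrite -[z]lreprK -!lclassZ_subproof scale1r. Qed.

Lemma lquot_scaleDr : right_distributive lquot_scale +%R.
Proof.
move=> c z w; rewrite -[z]lreprK -[w]lreprK -lclassD -!lclassZ_subproof.
by rewrite scalerDr lclassD.
Qed.

Lemma lquot_scaleDl z : {morph lquot_scale^~ z : a b / a + b}.
Proof.
by move=> a b; rewrite -[z]lreprK -!lclassZ_subproof scalerDl lclassD.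
Qed.

HB.instance Definition _ := GRing.Zmodule_isLmodule.Build k lquot
  lquot_scaleA lquot_scale1 lquot_scaleDr lquot_scaleDl.

Lemma lclass_linear : linear lclass.
Proof. by move=> c v w; rewrite lclassD lclassZ_subproof. Qed.

HB.instance Definition _ := GRing.isLinear.Build k V lquot *:%R lclass
  lclass_linear.

End QuotientModule.

Section Tensor.
Variables (k : comPzRingType) (R S T : nuAlgType k).
Variables (X : bimodType R S) (Y : bimodType S T).

Local Notation d x y := (delta k (x, y)).

Inductive tensor_rel : set (freemod k (X * Y)%type) :=
| TensorDl x x' y : tensor_rel (d (x + x') y - (d x y + d x' y))
| TensorDr x y y' : tensor_rel (d x (y + y') - (d x y + d x y'))
| TensorZl (c : k) x y : tensor_rel (d (c *: x) y - c *: d x y)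
| TensorZr (c : k) x y : tensor_rel (d x (c *: y) - c *: d x y)
| TensorA x (b : S) y : tensor_rel (d (x <* b) y - d x (b *> y)).

(* S need not be unital, so k-balancedness is imposed in tensor_rel besides
   S-balancedness. *)
Definition tensor := lquot (kspan_linear tensor_rel).
HB.instance Definition _ := GRing.Lmodule.on tensor.

Definition tens (x : X) (y : Y) : tensor :=
  lclass (kspan_linear tensor_rel) (d x y).

End Tensor.

Arguments tensor {k R S T} X Y.

Notation "x \ox y" := (tens x y) (at level 40, left associativity)
  : nualg_scope.

Section TensorTheory.
Variables (k : comPzRingType) (R S T : nuAlgType k).
Variables (X : bimodType R S) (Y : bimodType S T).

Lemma freemod_sumE (I : choiceType) (J : Type) (r : seq J)
    (F : J -> freemod k I) i :
  (\sum_(j <- r) F j) i = \sum_(j <- r) F j i.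
Proof.
by elim: r => [|j r IH]; rewrite ?big_nil // !big_cons -IH.
Qed.

Lemma freemod_decomp (I : choiceType) (f : freemod k I) (s : seq I) :
  uniq s -> (forall i, i \notin s -> f i = 0) ->
  f = \sum_(i <- s) (f i : k) *: delta k i.
Proof.
move=> us fs; apply: val_inj; apply/funext => i.
rewrite [RHS]freemod_sumE.
have dE j : ((f j : k) *: delta k j) i = (f j : k) * (i == j)%:R by [].
under eq_bigr do rewrite dE; have [si|si] := boolP (i \in s).
  rewrite (bigD1_seq i) //= eqxx big1 => [|j /negPf ji].
    by rewrite mulr1 addr0.
  by rewrite eq_sym ji mulr0.
rewrite big1_seq => [|j /andP[_ js]]; first exact: fs.
case: (eqVneq i j) => [ij|_]; last by rewrite mulr0.
by move: js; rewrite -ij (negPf si).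
Qed.

Lemma tensor_ind (P : set (tensor X Y)) :
  linear_set P -> (forall x y, P (x \ox y)) -> forall z, P z.
Proof.
move=> lP Pxy z; rewrite -[z]lreprK; 
have /fin_supp_seq[s [us fs]] : fin_supp (lrepr z).
  by apply/asboolP; exact: (valP (lrepr z)).
rewrite (freemod_decomp us fs) linear_sum; apply: linear_set_sum => // -[x y] _.
by rewrite linearZ; apply: linear_setZ => //; exact: Pxy.
Qed.

Lemma tensDl x x' y : (x + x') \ox y = x \ox y + x' \ox y :> tensor X Y.
Proof. by rewrite -lclassD; apply/lclass_eq/kspanS; exact: TensorDl. Qed.

Lemma tensDr x y y' : x \ox (y + y') = x \ox y + x \ox y' :> tensor X Y.
Proof. by rewrite -lclassD; apply/lclass_eq/kspanS; exact: TensorDr. Qed.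

Lemma tensZl c x y : (c *: x) \ox y = c *: (x \ox y) :> tensor X Y.
Proof. by rewrite -linearZ; apply/lclass_eq/kspanS; exact: TensorZl. Qed.

Lemma tensZr c x y : x \ox (c *: y) = c *: (x \ox y) :> tensor X Y.
Proof. by rewrite -linearZ; apply/lclass_eq/kspanS; exact: TensorZr. Qed.

Lemma tensA x b y : (x <* b) \ox y = x \ox (b *> y) :> tensor X Y.
Proof. by apply/lclass_eq/kspanS; exact: TensorA. Qed.

Lemma tensor_lift (M : lmodType k) (phi : X -> Y -> M) :
  (forall x x' y, phi (x + x') y = phi x y + phi x' y) ->
  (forall x y y', phi x (y + y') = phi x y + phi x y') ->
  (forall (c : k) x y, phi (c *: x) y = c *: phi x y) ->
  (forall (c : k) x y, phi x (c *: y) = c *: phi x y) ->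
  (forall x b y, phi (x <* b) y = phi x (b *> y)) ->
  exists F : {linear tensor X Y -> M}, forall x y, F (x \ox y) = phi x y.
Proof.
move=> phiDl phiDr phiZl phiZr phiA.
pose term (f : freemod k (X * Y)%type) p := (f p : k) *: phi p.1 p.2.
pose F0 (f : freemod k (X * Y)%type) : M :=
  \sum_(p \in [set: (X * Y)%type]) term f p.
have F0_seq (f : freemod k (X * Y)%type) (s : seq (X * Y)%type) : uniq s ->
    (forall p, p \notin s -> f p = 0) -> F0 f = \sum_(p <- s) term f p.
  by move=> us fs; apply: fsum_seq => // p /fs fp; rewrite /term fp scale0r.
have supp (f : freemod k (X * Y)%type) : fin_supp f.
  by apply/asboolP; exact: (valP f).
have F0_lin : linear F0.
  move=> c f g; have /fin_supp_seq[s [us fs]] := supp f.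
  have /fin_supp_seq[r [ur gr]] := supp g.
  pose q := undup (s ++ r); have uq : uniq q by exact: undup_uniq.
  have fq p : p \notin q -> f p = 0.
    by rewrite mem_undup mem_cat negb_or => /andP[/fs].
  have gq p : p \notin q -> g p = 0.
    by rewrite mem_undup mem_cat negb_or => /andP[_ /gr].
  have eE p : (c *: f + g) p = (c * f p + g p : k) by [].
  rewrite (F0_seq _ q) ?(F0_seq f q) ?(F0_seq g q) //; last first.
    by move=> p pq; rewrite eE fq // gq // mulr0 addr0.
  rewrite scaler_sumr -big_split; apply: eq_bigr => p _.
  by rewrite /term eE scalerDl scalerA.
have F0d x y : F0 (delta k (x, y)) = phi x y.
  rewrite (F0_seq _ [:: (x, y)]) // => [|p]; last first.
    by rewrite inE /= /delta_fun => /negPf ->.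
  by rewrite big_cons big_nil addr0 /term /= /delta_fun eqxx scale1r.
have [F1 F1E] : exists F1 : {linear freemod k (X * Y)%type -> M}, F1 =1 F0.
  pose H : {linear freemod k (X * Y)%type -> M} :=
    HB.pack F0 (GRing.isLinear.Build _ _ _ _ F0 F0_lin).
  by exists H.
have F1d x y : F1 (delta k (x, y)) = phi x y by rewrite F1E F0d.
have kerF1 : kspan (@tensor_rel _ _ _ _ X Y) `<=` [set v | F1 v = 0].
  apply: kspan_sub.
    split=> [|c f g /= Ff Fg]; first exact: linear0.
    by rewrite linearP Ff Fg scaler0 addr0.
  move=> v; case=> [x x' y|x y y'|c x y|c x y|x b y] /=; rewrite linearB.
  - by rewrite linearD !F1d phiDl subrr.
  - by rewrite linearD !F1d phiDr subrr.
  - by rewrite linearZ /= !F1d phiZl subrr.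
  - by rewrite linearZ /= !F1d phiZr subrr.
  - by rewrite !F1d phiA subrr.
pose F2 (z : tensor X Y) := F1 (lrepr z).
have F2E v : F2 (lclass (kspan_linear (@tensor_rel _ _ _ _ X Y)) v) = F1 v.
  apply/eqP; rewrite -subr_eq0 -linearB; apply/eqP/kerF1.
  by apply/(lclass_eq (kspan_linear _)); rewrite lreprK.
have F2_lin : linear F2.
  move=> c z w; rewrite -[z]lreprK -[w]lreprK -linearP.
  by rewrite !F2E linearP.
pose H : {linear tensor X Y -> M} :=
  HB.pack F2 (GRing.isLinear.Build _ _ _ _ F2 F2_lin).
by exists H => x y; rewrite -F1d -F2E.
Qed.

End TensorTheory.

(* tauA and tauB are bimodule maps, A acting on X (x)_B Y by
   a (x \ox y) = (a x) \ox y and (x \ox y) a = x \ox (y a); since pure tensors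
   span, compatibility is required on those. *)
Record morita_context (k : comPzRingType) (A B : nuAlgType k) := MoritaContext {
  mcX : bimodType A B;
  mcY : bimodType B A;
  tauA : {linear tensor mcX mcY -> A};
  tauB : {linear tensor mcY mcX -> B};
  tauA_lact : forall a x y, tauA ((a *> x) \ox y) = a ** tauA (x \ox y);
  tauA_ract : forall x y a, tauA (x \ox (y <* a)) = tauA (x \ox y) ** a;
  tauB_lact : forall b y x, tauB ((b *> y) \ox x) = b ** tauB (y \ox x);
  tauB_ract : forall y x b, tauB (y \ox (x <* b)) = tauB (y \ox x) ** b;
  tauA_tauB : forall x y x', tauA (x \ox y) *> x' = x <* tauB (y \ox x');
  tauB_tauA : forall y x y', tauB (y \ox x) *> y' = y <* tauA (x \ox y')
}.

Section StrongEquivalence.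
Variables (k : comPzRingType) (G : groupType) (A B : gradedAlgType k G).

Definition graded_morita (M : morita_context A B)
    (X_ : G -> set (mcX M)) (Y_ : G -> set (mcY M)) : Prop :=
  [/\ graded_bimodule X_, graded_bimodule Y_,
      forall r s x y, X_ r x -> Y_ s y -> homog A (r * s)%g (tauA M (x \ox y)) &
      forall r s y x, Y_ r y -> X_ s x -> homog B (r * s)%g (tauB M (y \ox x))].

Definition strong_morita (M : morita_context A B)
    (X_ : G -> set (mcX M)) (Y_ : G -> set (mcY M)) : Prop :=
  forall t : G,
    unital_for (Dideal A t) (X_ t) (Dideal B t^-1%g) /\
    unital_for (Dideal B t) (Y_ t) (Dideal A t^-1%g).

Definition strongly_graded_equivalent : Prop :=
  [/\ idempotent_set [set: A], idempotent_set [set: B],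
      forall t, idempotent_set (Dideal A t),
      forall t, idempotent_set (Dideal B t) &
      exists (M : morita_context A B)
             (X_ : G -> set (mcX M)) (Y_ : G -> set (mcY M)),
        [/\ graded_morita X_ Y_ /\ strong_morita X_ Y_,
            forall a : A, exists z, tauA M z = a,
            forall b : B, exists z, tauB M z = b,
            forall t : G,
              kspan [set tauA M (x \ox y) | x in X_ t & y in Y_ t^-1%g]
              = Dideal A t &
            forall t : G,
              kspan [set tauB M (y \ox x) | y in Y_ t & x in X_ t^-1%g]
              = Dideal B t]].

End StrongEquivalence.

Section Smash.
Variables (k : comPzRingType) (G : groupType) (B : gradedAlgType k G).

Lemma homog_linear (t : G) : linear_set (homog B t).
Proof. exact: (homog_direct.1 t). Qed.

(* f (r, s) is the coefficient of e_{r,s}. *)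
Definition smash_pred : {pred (G * G)%type -> B} :=
  fun f => `[< fin_supp f /\ forall r s, homog B (r^-1 * s)%g (f (r, s)) >].

Lemma smash_pred_submod : submod_closed smash_pred.
Proof.
split=> [|c f g /asboolP[ff hf] /asboolP[fg hg]]; apply/asboolP.
  by split=> [|r s]; [exact: fin_supp0 | exact: (homog_linear _).1].
split=> [|r s]; first exact: fin_suppD.
exact: (homog_linear _).2.
Qed.

HB.instance Definition _ :=
  GRing.isSubmodClosed.Build k ((G * G)%type -> B) smash_pred smash_pred_submod.

Record smash :=
  Smash { smash_fun :> (G * G)%type -> B; _ : smash_fun \in smash_pred }.

HB.instance Definition _ := [isSub for smash_fun].
HB.instance Definition _ := [Choice of smash by <:].
HB.instance Definition _ := [SubChoice_isSubLmodule of smash by <:].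

Implicit Types f g h : smash.

Lemma smash_supp f : fin_supp f.
Proof. by have /asboolP[] := valP f. Qed.

Lemma smash_homog f r s : homog B (r^-1 * s)%g (f (r, s)).
Proof. by have /asboolP[_] := valP f. Qed.

Lemma smashP f g : (forall r s, f (r, s) = g (r, s)) -> f = g.
Proof. by move=> fg; apply: val_inj; apply/funext => -[r s]; apply: fg. Qed.

Lemma smashD f g p : (f + g) p = f p + g p. Proof. by []. Qed.
Lemma smashZ (c : k) f p : (c *: f) p = c *: f p. Proof. by []. Qed.

Lemma smash_seq f : exists s : seq G,
  forall r t, (r \notin s) || (t \notin s) -> f (r, t) = 0.
Proof.
have [s [us fs]] := fin_supp_seq (smash_supp f).
exists ([seq p.1 | p <- s] ++ [seq p.2 | p <- s]) => r t rt; apply: fs.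
apply: contraTN rt => rts; rewrite negb_or !negbK !mem_cat.
by rewrite (map_f fst rts) (map_f snd rts) orbT.
Qed.

Definition smash_mul_fun f g : (G * G)%type -> B :=
  fun p => \sum_(t \in [set: G]) f (p.1, t) ** g (t, p.2).

Lemma smash_mul_seq f g (s : seq G) p : uniq s ->
  (forall r t, (r \notin s) || (t \notin s) -> f (r, t) = 0) ->
  smash_mul_fun f g p = \sum_(t <- s) f (p.1, t) ** g (t, p.2).
Proof.
move=> us fs; apply: fsum_seq => // t ts.
by rewrite fs ?ts ?orbT // amul0l.
Qed.

Lemma smash_mul_subproof f g : smash_mul_fun f g \in smash_pred.
Proof.
apply/asboolP; split=> [|r s]; last first.
  apply: linear_fsum => [|t]; first exact: homog_linear.
  have -> : (r^-1 * s = (r^-1 * t) * (t^-1 * s))%g.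
    by rewrite -mulgA mulVKg.
  by apply: homogM; apply: smash_homog.
have [sf hf] := smash_seq f; have [sg hg] := smash_seq g.
have fin : finite_set [set` [seq (r, s) | r <- sf, s <- sg]].
  exact: finite_seq.
apply: (sub_finite_set _ fin) => -[r s] /=; apply: contraR => rs.
apply/eqP/fsbig1 => t _ /=.
have [rf|rf] := boolP (r \in sf); last by rewrite hf ?rf // amul0l.
have [sg'|sg'] := boolP (s \in sg); last by rewrite hg ?sg' ?orbT // amul0r.
by case/negP: rs; apply/allpairsP; exists (r, s).
Qed.

Definition smash_mul f g : smash := Smash (smash_mul_subproof f g).

Lemma smash_seqs f g h : exists s : seq G, [/\ uniq s,
  forall r t, (r \notin s) || (t \notin s) -> f (r, t) = 0,
  forall r t, (r \notin s) || (t \notin s) -> g (r, t) = 0 &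
  forall r t, (r \notin s) || (t \notin s) -> h (r, t) = 0].
Proof.
have [sf hf] := smash_seq f; have [sg hg] := smash_seq g.
have [sh hh] := smash_seq h; exists (undup (sf ++ sg ++ sh)).
split; first exact: undup_uniq.
- move=> r t rt; apply: hf; move: rt; rewrite !mem_undup !mem_cat.
  by case: (r \in sf) => //=; case: (t \in sf).
- move=> r t rt; apply: hg; move: rt; rewrite !mem_undup !mem_cat.
  by case: (r \in sg); case: (t \in sg); rewrite //= ?orbT.
- move=> r t rt; apply: hh; move: rt; rewrite !mem_undup !mem_cat.
  by case: (r \in sh); case: (t \in sh); rewrite //= ?orbT.
Qed.

Lemma smash_mulA : associative smash_mul.
Proof.
move=> f g h; have [s [us fs gs hs]] := smash_seqs f g h.
have fgs r t : (r \notin s) || (t \notin s) -> smash_mul f g (r, t) = 0.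
  move=> rt; rewrite /= (smash_mul_seq _ _ us fs) /= big1 // => u _.
  case/orP: rt => rt; first by rewrite fs ?rt // amul0l.
  by rewrite gs ?rt ?orbT // amul0r.
apply: smashP => r t /=.
rewrite (smash_mul_seq _ _ us fs) (smash_mul_seq _ _ us fgs) /=.
under eq_bigr do rewrite (smash_mul_seq _ _ us gs) /= amul_sumr.
under [RHS]eq_bigr do rewrite (smash_mul_seq _ _ us fs) /= amul_suml.
rewrite exchange_big /=; apply: eq_bigr => u _; apply: eq_bigr => v _.
exact: amulA.
Qed.

Lemma smash_mulDl : left_distributive smash_mul +%R.
Proof.
move=> f g h; have [s [us fs gs hs]] := smash_seqs f g (f + g).
apply: smashP => r t; rewrite smashD /=.
rewrite (smash_mul_seq _ _ us fs) (smash_mul_seq _ _ us gs).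
rewrite (smash_mul_seq _ _ us hs) -big_split; apply: eq_bigr => u _ /=.
by rewrite -amulDl.
Qed.

Lemma smash_mulDr : right_distributive smash_mul +%R.
Proof.
move=> f g h; have [s [us fs gs hs]] := smash_seqs f g h.
apply: smashP => r t; rewrite smashD /= !(smash_mul_seq _ _ us fs).
by rewrite -big_split; apply: eq_bigr => u _ /=; rewrite -amulDr.
Qed.

Lemma smash_mulZl (c : k) f g : smash_mul (c *: f) g = c *: smash_mul f g.
Proof.
have [s [us fs gs hs]] := smash_seqs f g (c *: f).
apply: smashP => r t; rewrite smashZ /=.
rewrite (smash_mul_seq _ _ us fs) (smash_mul_seq _ _ us hs) scaler_sumr.
by apply: eq_bigr => u _; rewrite -amulZl.
Qed.

Lemma smash_mulZr (c : k) f g : smash_mul f (c *: g) = c *: smash_mul f g.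
Proof.
have [s [us fs gs hs]] := smash_seqs f g g.
apply: smashP => r t; rewrite smashZ /= !(smash_mul_seq _ _ us fs) scaler_sumr.
by apply: eq_bigr => u _; rewrite -amulZr.
Qed.

HB.instance Definition _ := Lmodule_isNUAlgebra.Build k smash
  smash_mulA smash_mulDl smash_mulDr smash_mulZl smash_mulZr.

Lemma smashM f g r s :
  (f ** g) (r, s) = \sum_(t \in [set: G]) f (r, t) ** g (t, s).
Proof. by []. Qed.

End Smash.

Section Beta.
Variables (k : comPzRingType) (G : groupType) (B : gradedAlgType k G).
Implicit Types (f g : smash B) (r s t : G).

(* Entrywise form of the action b e_{r,s} |-> b e_{tr,ts}. *)
Definition beta_fun t f : (G * G)%type -> B :=
  fun p => f (t^-1 * p.1, t^-1 * p.2)%g.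

Lemma beta_subproof t f : beta_fun t f \in @smash_pred _ _ B.
Proof.
apply/asboolP; split=> [|r s]; last first.
  have -> : (r^-1 * s = (t^-1 * r)^-1 * (t^-1 * s))%g.
    by rewrite invgM invgK -mulgA mulVKg.
  exact: smash_homog.
have fin := finite_image (fun p => (t * p.1, t * p.2)%g) (smash_supp f).
apply: sub_finite_set fin => -[r s] /= h.
by exists (t^-1 * r, t^-1 * s)%g; rewrite //= !mulVKg.
Qed.

Definition beta t f : smash B := Smash (beta_subproof t f).

Lemma betaE t f r s : beta t f (r, s) = f (t^-1 * r, t^-1 * s)%g.
Proof. by []. Qed.

Lemma beta_linear t : linear (beta t).
Proof. by move=> c f g; apply: smashP. Qed.

HB.instance Definition _ t :=
  GRing.isLinear.Build k (smash B) (smash B) *:%R (beta t) (beta_linear t).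

Lemma beta1 f : beta 1%g f = f.
Proof. by apply: smashP => r s; rewrite betaE invg1 !mul1g. Qed.

Lemma betaM s t f : beta s (beta t f) = beta (s * t)%g f.
Proof. by apply: smashP => r u; rewrite !betaE invgM !mulgA. Qed.

Lemma betaK t f : beta t^-1%g (beta t f) = f.
Proof. by rewrite betaM mulVg beta1. Qed.

Lemma betaVK t f : beta t (beta t^-1%g f) = f.
Proof. by rewrite betaM mulgV beta1. Qed.

Lemma beta_amul t f g : beta t (f ** g) = beta t f ** beta t g.
Proof.
apply: smashP => r s; rewrite betaE !smashM.
rewrite (reindex_fsbigT (fun u => t^-1 * u)%g) //.
by exists (fun u => t * u)%g => u; rewrite ?mulVKg ?mulKg.
Qed.

(* I^B, the direct sum of the B_{r^-1} B_s e_{r,s}. *)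
Definition psmash : set (smash B) :=
  [set f | forall r s, (homog B r^-1%g `** homog B s) (f (r, s))].

(* I_t := I beta_t(I), the domain in degree t of the canonical partial action
   gamma, which is beta_t restricted to I_{t^-1} -> I_t. *)
Definition psmash_dom t : set (smash B) := psmash `** (beta t @` psmash).

Lemma psmash_linear : linear_set psmash.
Proof.
split=> [r s|c f g If Ig r s]; first exact: (mulset_linear _ _).1.
exact: (mulset_linear _ _).2.
Qed.

Lemma psmash_idealr f g : psmash f -> psmash (f ** g).
Proof.
move=> If r s; rewrite smashM; apply: linear_fsum => [|t].
  exact: mulset_linear.
apply: (@mulset_sub _ _ _ _
  [set x | (homog B r^-1%g `** homog B s) (x ** g (t, s))] _ _ _ (If r t)).
  split=> [|c x y /= hx hy]; first by rewrite /= amul0l; exact: (mulset_linear _ _).1.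
  by rewrite amulDl amulZl; apply: (mulset_linear _ _).2.
move=> x y hx hy /=; rewrite -amulA; apply: mem_mulset => //.
by have := homogM _ _ _ _ hy (smash_homog g t s); rewrite mulVKg.
Qed.

Lemma psmash_ideall f g : psmash g -> psmash (f ** g).
Proof.
move=> Ig r s; rewrite smashM; apply: linear_fsum => [|t].
  exact: mulset_linear.
apply: (@mulset_sub _ _ _ _
  [set x | (homog B r^-1%g `** homog B s) (f (r, t) ** x)] _ _ _ (Ig t s)).
  split=> [|c x y /= hx hy]; first by rewrite /= amul0r; exact: (mulset_linear _ _).1.
  by rewrite amulDr amulZr; apply: (mulset_linear _ _).2.
move=> x y hx hy /=; rewrite amulA; apply: mem_mulset => //.
by have := homogM _ _ _ _ (smash_homog f r t) hx; rewrite mulgK.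
Qed.

(* (a delta_r)(b delta_s) = gamma_r (gamma_r^-1 (a) b) delta_{rs} for a in I_r
   and b in I_s, where gamma_r^-1 is the restriction of beta_{r^-1} to I_r. *)
Definition skew_term r (a b : smash B) : smash B :=
  beta r (beta r^-1%g a ** b).

Lemma skew_termE r a b : skew_term r a b = a ** beta r b.
Proof. by rewrite /skew_term beta_amul betaVK. Qed.

Lemma skew_term_dom r s a b :
  psmash_dom r a -> psmash_dom s b -> psmash_dom (r * s)%g (skew_term r a b).
Proof.
rewrite skew_termE => Da Db.
have Ia : psmash a.
  apply: mulset_sub Da; first exact: psmash_linear.
  by move=> x y Ix _; apply: psmash_idealr.
pose P := [set y | psmash_dom (r * s)%g (a ** beta r y)].
apply: (@mulset_sub _ _ _ _ P _ _ _ Db).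
  split=> [|c x y /= hx hy]; rewrite /P /=.
    by rewrite linear0 amul0r; exact: (mulset_linear _ _).1.
  by rewrite linearP amulDr amulZr; apply: (mulset_linear _ _).2.
move=> x _ Ix [y Iy <-]; rewrite /P /= beta_amul betaM amulA.
by apply: mem_mulset; [exact: psmash_idealr | exists y].
Qed.

End Beta.

Section Skew.
Variables (k : comPzRingType) (G : groupType) (B : gradedAlgType k G).

(* The family (a_t)_t stands for the sum of the a_t delta_t. *)
Definition skew_pred : {pred G -> smash B} :=
  fun f => `[< fin_supp f /\ forall t, psmash_dom t (f t) >].

Lemma skew_pred_submod : submod_closed skew_pred.
Proof.
split=> [|c f g /asboolP[ff hf] /asboolP[fg hg]]; apply/asboolP.
  by split=> [|t]; [exact: fin_supp0 | exact: (mulset_linear _ _).1].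
split=> [|t]; first exact: fin_suppD.
exact: ((mulset_linear _ _).2 c _ _ (hf t) (hg t)).
Qed.

HB.instance Definition _ :=
  GRing.isSubmodClosed.Build k (G -> smash B) skew_pred skew_pred_submod.

Record partial_skew_algebra :=
  Skew { skew_fun :> G -> smash B; _ : skew_fun \in skew_pred }.

HB.instance Definition _ := [isSub for skew_fun].
HB.instance Definition _ := [Choice of partial_skew_algebra by <:].
HB.instance Definition _ :=
  [SubChoice_isSubLmodule of partial_skew_algebra by <:].

Implicit Types f g h : partial_skew_algebra.

Lemma skew_supp f : fin_supp f.
Proof. by have /asboolP[] := valP f. Qed.

Lemma skew_dom f t : psmash_dom t (f t).
Proof. by have /asboolP[_] := valP f. Qed.

Lemma skewP f g : (forall t, f t = g t) -> f = g.
Proof. by move=> fg; apply: val_inj; apply/funext => t; apply: fg. Qed.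

Lemma skewD f g t : (f + g) t = f t + g t. Proof. by []. Qed.
Lemma skewZ (c : k) f t : (c *: f) t = c *: f t. Proof. by []. Qed.

Lemma skew_sumE (J : Type) (r : seq J) (F : J -> partial_skew_algebra) t :
  (\sum_(j <- r) F j) t = \sum_(j <- r) F j t.
Proof.
by elim: r => [|j r IH]; rewrite ?big_nil // !big_cons -IH.
Qed.

Definition skew_mul_fun f g : G -> smash B :=
  fun u => \sum_(r \in [set: G]) skew_term r (f r) (g (r^-1 * u)%g).

Lemma skew_mul_seq f g (s : seq G) u : uniq s ->
  (forall r, r \notin s -> f r = 0) ->
  skew_mul_fun f g u = \sum_(r <- s) f r ** beta r (g (r^-1 * u)%g).
Proof.
move=> us fs; rewrite /skew_mul_fun (fsum_seq us).
  by apply: eq_bigr => r _; rewrite skew_termE.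
by move=> r /fs fr; rewrite skew_termE fr amul0l.
Qed.

Lemma skew_mul_subproof f g : skew_mul_fun f g \in skew_pred.
Proof.
apply/asboolP; split=> [|u]; last first.
  apply: linear_fsum => [|r]; first exact: mulset_linear.
  have := skew_term_dom (skew_dom f r) (skew_dom g (r^-1 * u)%g).
  by rewrite mulVKg.
have [sf [uf hf]] := fin_supp_seq (skew_supp f).
have [sg [ug hg]] := fin_supp_seq (skew_supp g).
have fin : finite_set [set` [seq (r * s)%g | r <- sf, s <- sg]].
  exact: finite_seq.
apply: (sub_finite_set _ fin) => u /=; apply: contraR => ufg.
apply/eqP/fsbig1 => r _ /=; rewrite skew_termE.
have [rf|/hf ->] := boolP (r \in sf); last by rewrite amul0l.
have [rg|/hg ->] := boolP (r^-1 * u \in sg)%g; last by rewrite linear0 amul0r.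
by case/negP: ufg; apply/allpairsP; exists (r, r^-1 * u)%g; rewrite /= mulVKg.
Qed.

Definition skew_mul f g : partial_skew_algebra := Skew (skew_mul_subproof f g).

Lemma skew_mulA : associative skew_mul.
Proof.
move=> f g h.
have [sf [uf hf]] := fin_supp_seq (skew_supp f).
have [sg [ug hg]] := fin_supp_seq (skew_supp g).
have [sfg [ufg hfg]] := fin_supp_seq (skew_supp (skew_mul f g)).
pose q := undup (sfg ++ [seq (r * s)%g | r <- sf, s <- sg]).
have uq : uniq q by exact: undup_uniq.
have hq r : r \notin q -> skew_mul f g r = 0.
  by rewrite mem_undup mem_cat negb_or => /andP[/hfg].
apply: skewP => u /=.
rewrite (skew_mul_seq _ _ uf hf) (skew_mul_seq _ _ uq hq).
under eq_bigr do rewrite /= (skew_mul_seq _ _ ug hg) linear_sum amul_sumr.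
under [RHS]eq_bigr do rewrite /= (skew_mul_seq _ _ uf hf) amul_suml.
rewrite [RHS]exchange_big /= [LHS]big_seq [RHS]big_seq.
apply: eq_bigr => r rf.
pose F p := f r ** beta r (g (r^-1 * p)%g) ** beta p (h (p^-1 * u)%g).
transitivity (\sum_(s <- sg) F (r * s)%g).
  apply: eq_bigr => s _; rewrite /F mulKg beta_amul betaM amulA.
  by rewrite invgM mulgA.
rewrite -(big_map (fun s => r * s)%g predT F) -[RHS]/(\sum_(p <- q) F p).
have us : uniq [seq (r * s)%g | s <- sg].
  by rewrite map_inj_uniq //; exact: mulgI.
rewrite -(fsum_seq us) => [|p ps]; last first.
  rewrite /F hg ?linear0 ?amul0r ?amul0l //; apply: contraNN ps => ps.
  by apply/mapP; exists (r^-1 * p)%g => //; rewrite mulVKg.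
rewrite (fsum_seq uq) // => p; rewrite mem_undup mem_cat negb_or => /andP[_ pq].
rewrite /F hg ?linear0 ?amul0r ?amul0l //; apply: contraNN pq => ps.
by apply/allpairsP; exists (r, r^-1 * p)%g; rewrite /= mulVKg.
Qed.

Lemma skew_mulDl : left_distributive skew_mul +%R.
Proof.
move=> f g h.
have [sf [uf hf]] := fin_supp_seq (skew_supp f).
have [sg [ug hg]] := fin_supp_seq (skew_supp g).
pose q := undup (sf ++ sg); have uq : uniq q by exact: undup_uniq.
have hq : forall r, r \notin q -> (f r = 0) * (g r = 0).
  move=> r; rewrite mem_undup mem_cat negb_or => /andP[rf rg].
  by rewrite hf ?hg.
apply: skewP => u; rewrite skewD /=.
have hf' r : r \notin q -> f r = 0 by case/hq.
have hg' r : r \notin q -> g r = 0 by case/hq.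
have hfg r : r \notin q -> (f + g) r = 0.
  by move=> rq; rewrite skewD hf' ?hg' ?addr0.
rewrite (skew_mul_seq _ _ uq hf') (skew_mul_seq _ _ uq hg').
rewrite (skew_mul_seq _ _ uq hfg) -big_split; apply: eq_bigr => r _ /=.
by rewrite -amulDl.
Qed.

Lemma skew_mulDr : right_distributive skew_mul +%R.
Proof.
move=> f g h; have [sf [uf hf]] := fin_supp_seq (skew_supp f).
apply: skewP => u; rewrite skewD /= !(skew_mul_seq _ _ uf hf) -big_split.
by apply: eq_bigr => r _ /=; rewrite -amulDr -linearD.
Qed.

Lemma skew_mulZl (c : k) f g : skew_mul (c *: f) g = c *: skew_mul f g.
Proof.
have [sf [uf hf]] := fin_supp_seq (skew_supp f).
have hcf r : r \notin sf -> (c *: f) r = 0.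
  by move=> /hf fr; rewrite skewZ fr scaler0.
apply: skewP => u; rewrite skewZ /=.
rewrite (skew_mul_seq _ _ uf hf) (skew_mul_seq _ _ uf hcf) scaler_sumr.
by apply: eq_bigr => r _; rewrite -amulZl.
Qed.

Lemma skew_mulZr (c : k) f g : skew_mul f (c *: g) = c *: skew_mul f g.
Proof.
have [sf [uf hf]] := fin_supp_seq (skew_supp f).
apply: skewP => u; rewrite skewZ /= !(skew_mul_seq _ _ uf hf) scaler_sumr.
by apply: eq_bigr => r _; rewrite -amulZr -linearZ.
Qed.

HB.instance Definition _ := Lmodule_isNUAlgebra.Build k partial_skew_algebra
  skew_mulA skew_mulDl skew_mulDr skew_mulZl skew_mulZr.

Definition skew_homog (t : G) : set partial_skew_algebra :=
  [set f | forall s, s != t -> f s = 0].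

Lemma skew_homog_linear t : linear_set (skew_homog t).
Proof.
split=> [s //|c f g hf hg s st].
by rewrite skewD skewZ hf // hg // scaler0 addr0.
Qed.

Definition skew_single_fun (t : G) (f : partial_skew_algebra) : G -> smash B :=
  fun s => if s == t then f s else 0.

Lemma skew_single_subproof t f : skew_single_fun t f \in skew_pred.
Proof.
apply/asboolP; split=> [|s]; last first.
  rewrite /skew_single_fun; case: ifP => _; first exact: skew_dom.
  exact: (mulset_linear _ _).1.
apply: (sub_finite_set _ (finite_set1 t)) => s /=; rewrite /skew_single_fun.
by case: (eqVneq s t) => // _; rewrite eqxx.
Qed.

Definition skew_single t f : partial_skew_algebra :=
  Skew (skew_single_subproof t f).

Lemma skew_direct : direct_sum skew_homog.
Proof.
split=> [t|f]; first exact: skew_homog_linear.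
have sumE (F : G -> partial_skew_algebra) :
    fin_supp F -> (forall t, skew_homog t (F t)) ->
    forall t, (\sum_(i \in [set: G]) F i) t = F t t.
  move=> finF hF t; have [s [us Fs]] := fin_supp_seq finF.
  rewrite (fsum_seq us Fs) skew_sumE; have [ts|ts] := boolP (t \in s).
    rewrite (bigD1_seq t) //= big1 ?addr0 // => i it.
    by apply: hF; rewrite eq_sym.
  rewrite big1_seq ?Fs // => i /andP[_ is_]; apply: hF.
  by apply: contraNneq ts => ->.
have fin1 : fin_supp (fun t => skew_single t f).
  apply: sub_finite_set (skew_supp f) => t /=; apply: contraNN => /eqP ft.
  apply/eqP/skewP => s /=; rewrite /skew_single_fun.
  by case: eqVneq => // ->.
have hom1 t : skew_homog t (skew_single t f).
  by move=> s /negPf st /=; rewrite /skew_single_fun st.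
exists (fun t => skew_single t f); split.
  split=> //; apply: skewP => t.
  by rewrite sumE //= /skew_single_fun eqxx.
move=> F [finF hF fF]; apply/funext => t; apply: skewP => s /=.
rewrite /skew_single_fun; case: (eqVneq s t) => [->|st]; last by rewrite hF.
by rewrite fF sumE.
Qed.

Lemma skew_homogM s t (f g : partial_skew_algebra) :
  skew_homog s f -> skew_homog t g -> skew_homog (s * t)%g (f ** g).
Proof.
move=> hf hg u ust; apply: fsbig1 => r _; rewrite skew_termE.
have [->|rs] := eqVneq r s; last by rewrite hf // amul0l.
rewrite hg ?linear0 ?amul0r //; apply: contraNneq ust => <-.
by rewrite mulVKg.
Qed.

HB.instance Definition _ :=
  NUAlgebra_isGraded.Build k G partial_skew_algebra skew_direct skew_homogM.

End Skew.

(* Main.v *)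
From HB Require Import structures.
Require Import Defs.
From mathcomp Require Import all_boot all_algebra.
From mathcomp Require Import boolp classical_sets functions cardinality fsbigop.

Set Implicit Arguments.
Unset Strict Implicit.
Unset Printing Implicit Defensive.

Import GRing.Theory.

Local Open Scope classical_set_scope.
Local Open Scope ring_scope.

(** Write C for the partial skew group algebra and B_t for the homogeneous
    components of B.  The ideal I beta_t(I) consists of the matrices whose
    (r,s) entry lies in B_{r^-1} B_t B_{t^-1 s}.  Sending b e_{r,tu} delta_t to
    b placed at row r and column u turns the product of C into the ordinary
    matrix product: C is an algebra of G x G matrices over B in which the
    degree t part has its (r,u) entry in B_{r^-1} B_t B_u.  As
    B_1 B_t = B_t = B_t B_1 in a partially-strongly-graded algebra, the (1,1)
    corner of this matrix algebra is B itself, and the equivalence is the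
    classical one between a matrix algebra and a full corner: X is the first
    row of C, Y is its first column, both pairings are multiplication in C,
    and every associativity law of a Morita context is associativity in C.

    Thus X_t has its u-th entry in B_t B_u and Y_t its r-th entry in
    B_{r^-1} B_t.  Strongness rests on three identities between products of
    subspaces of C, in which B_t is viewed inside the corner.  First,
    C_t C_{t^-1} = Y_t X_{t^-1}: in a product of entries from
    B_{r^-1} B_t B_u and B_{u^-1} B_{t^-1} B_v, the factors B_u B_{u^-1} can
    be absorbed into the degree t^-1 part, so that the summation index u may
    be taken to be 1.  Secondly, X_t Y_{t^-1} = B_t B_{t^-1} for the same
    reason.  Thirdly, B_t B_{t^-1} X_t = X_t and Y_t B_{t^-1} B_t = Y_t, which
    is B_t B_{t^-1} B_t = B_t.  All remaining unitality and idempotence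
    conditions follow by associativity, for example
    X_t (C_{t^-1} C_t) = X_t Y_{t^-1} X_t = B_t B_{t^-1} X_t = X_t.

    The formal deduction from these identities is corner_equivalence, stated
    for an arbitrary graded algebra C and corner embedding iota; the matrix
    computations are skew_Dideal_sub, row1_mul_col1, row1_unital, col1_unital
    and corner_is_full. *)

(** * Subspaces and products of subspaces *)

Section Spans.
Variable k : comPzRingType.

Lemma linear_setI (V : lmodType k) (S T : set V) :
  linear_set S -> linear_set T -> linear_set (S `&` T).
Proof.
move=> [S0 Sl] [T0 Tl]; split=> // c x y [Sx Tx] [Sy Ty].
by split; [exact: Sl | exact: Tl].
Qed.

Lemma linear_preimage (V W : lmodType k) (f : {linear V -> W}) (T : set W) :
  linear_set T -> linear_set (f @^-1` T).
Proof.
move=> [T0 Tl]; split=> [|c x y Tx Ty]; rewrite /preimage /= ?linear0 //.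
by rewrite linearP; apply: Tl.
Qed.

Lemma linear_range (V W : lmodType k) (f : {linear V -> W}) :
  linear_set (range f).
Proof.
split; first by exists 0; rewrite ?linear0.
by move=> c _ _ [x _ <-] [y _ <-]; exists (c *: x + y); rewrite ?linearP.
Qed.

Lemma image_kspan (V W : lmodType k) (f : {linear V -> W}) (S : set V) :
  f @` kspan S = kspan (f @` S).
Proof.
apply/seteqP; split=> [_ [_ [n [c [s [Ss ->]]]] <-]|].
  exists n, c, (f \o s); split=> [i|]; first by exists (s i).
  by rewrite linear_sum; apply: eq_bigr => i _; rewrite linearZ.
apply: kspan_sub => [|_ [x Sx <-]]; last by exists x => //; apply: kspanS.
split; first by exists 0; [exact: (kspan_linear _).1 | exact: linear0].
move=> c _ _ [x Sx <-] [y Sy <-]; exists (c *: x + y); last exact: linearP.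
exact: (kspan_linear _).2.
Qed.

Lemma linear_fsumE (V W : lmodType k) (T : choiceType) (f : {linear V -> W})
    (F : T -> V) : fin_supp F ->
  f (\sum_(t \in [set: T]) F t) = \sum_(t \in [set: T]) f (F t).
Proof.
move=> /fin_supp_seq[s [us Fs]].
rewrite (fsum_seq us Fs) (fsum_seq us) => [|t /Fs ->]; last exact: linear0.
exact: linear_sum.
Qed.


Variable A : nuAlgType k.
Implicit Types (U V W T : set A) (x y : A).

Lemma linear_lmul T x : linear_set T -> linear_set [set y | T (x ** y)].
Proof.
move=> [T0 Tl]; split=> [|c y z Ty Tz] /=; first by rewrite amul0r.
by rewrite amulDr amulZr; apply: Tl.
Qed.

Lemma linear_rmul T y : linear_set T -> linear_set [set x | T (x ** y)].
Proof.
move=> [T0 Tl]; split=> [|c x z Tx Tz] /=; first by rewrite amul0l.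
by rewrite amulDl amulZl; apply: Tl.
Qed.

Lemma mulsetS U U' V V' : U `<=` U' -> V `<=` V' -> U `** V `<=` U' `** V'.
Proof.
move=> UU VV; apply: mulset_sub => [|x y Ux Vy]; first exact: mulset_linear.
by apply: mem_mulset; [exact: UU | exact: VV].
Qed.

Lemma mulsetA U V W : U `** (V `** W) = U `** V `** W.
Proof.
apply/seteqP; split.
  apply: mulset_sub => [|x y Ux VWy]; first exact: mulset_linear.
  move: y VWy; apply: (mulset_sub (linear_lmul x (mulset_linear _ _))).
  move=> y z Vy Wz /=; rewrite amulA.
  by apply: mem_mulset => //; apply: mem_mulset.
apply: mulset_sub => [|x z UVx Wz]; first exact: mulset_linear.
move: x UVx; apply: (mulset_sub (linear_rmul z (mulset_linear _ _))).
move=> x y Ux Vy /=; rewrite -amulA.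
by apply: mem_mulset => //; apply: mem_mulset.
Qed.

Lemma image_inj_eq (V W : Type) (f : V -> W) (S T : set V) :
  injective f -> f @` S = f @` T -> S = T.
Proof.
move=> f_inj; suff sub P Q : f @` P = f @` Q -> P `<=` Q.
  by move=> ST; apply/seteqP; split; apply: sub.
move=> PQ x Px; have : (f @` Q) (f x) by rewrite -PQ; exists x.
by case=> y Qy /f_inj <-.
Qed.

Lemma image_mulset (A' : nuAlgType k) (f : {linear A -> A'}) U V :
  (forall x y, f (x ** y) = f x ** f y) ->
  f @` (U `** V) = (f @` U) `** (f @` V).
Proof.
move=> fM; rewrite image_kspan; congr kspan; apply/seteqP; split=> z.
  move=> [_ [x Ux [y Vy <-]] <-]; exists (f x); first by exists x.
  by exists (f y); [exists y | rewrite fM].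
move=> [_ [x Ux <-] [_ [y Vy <-] <-]]; exists (x ** y); last exact: fM.
by exists x => //; exists y.
Qed.

End Spans.

(** * Homogeneous components *)

Section Homogeneous.
Variables (k : comPzRingType) (G : groupType) (A : gradedAlgType k G).

Definition hcomp (a : A) : G -> A := sval (cid (homog_direct.2 a)).

Lemma hcompP a : [/\ fin_supp (hcomp a), forall t, homog A t (hcomp a t) &
  a = \sum_(t \in [set: G]) hcomp a t].
Proof. by rewrite /hcomp; case: cid => f []. Qed.

Lemma hcomp_unique a (F : G -> A) : fin_supp F ->
  (forall t, homog A t (F t)) -> a = \sum_(t \in [set: G]) F t ->
  hcomp a = F.
Proof.
by move=> fF hF aF; rewrite /hcomp; case: cid => f [_ /=]; apply.
Qed.

Lemma hcomp_linear t : linear (fun a => hcomp a t).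
Proof.
move=> c a b; have [fa ha aE] := hcompP a; have [fb hb bE] := hcompP b.
rewrite (@hcomp_unique _ (c *: hcomp a + hcomp b)) //; first exact: fin_suppD.
  by move=> s; exact: (homog_linear A s).2 c _ _ (ha s) (hb s).
have [s [us s0]] := fin_supp_seq fa; have [q [uq q0]] := fin_supp_seq fb.
pose r := undup (s ++ q).
have ur : uniq r by exact: undup_uniq.
have a0 u : u \notin r -> hcomp a u = 0.
  by rewrite mem_undup mem_cat negb_or => /andP[/s0].
have b0 u : u \notin r -> hcomp b u = 0.
  by rewrite mem_undup mem_cat negb_or => /andP[_ /q0].
rewrite {1}aE {1}bE (fsum_seq ur a0) (fsum_seq ur b0) (fsum_seq ur).
  by rewrite scaler_sumr -big_split.
by move=> u ur'; rewrite !fctE a0 // b0 // scaler0 addr0.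
Qed.

Lemma hcomp_homog t a : homog A t a ->
  hcomp a = fun s => if s == t then a else 0.
Proof.
move=> ha; apply: hcomp_unique.
- apply: (sub_finite_set _ (finite_set1 t)) => s /=.
  by case: (eqVneq s t) => // _; rewrite eqxx.
- by move=> s; case: eqVneq => [->//|_]; exact: (homog_linear A _).1.
- rewrite (@fsum_seq _ _ _ _ [:: t]) //; last first.
    by move=> s; rewrite inE => /negPf ->.
  by rewrite big_cons big_nil addr0 eqxx.
Qed.

Lemma homog_ind (T : set A) (a : A) : linear_set T ->
  (forall t, T (hcomp a t)) -> T a.
Proof.
by move=> lT Ta; have [_ _ ->] := hcompP a; apply: linear_fsum.
Qed.

End Homogeneous.

(** * Bimodules inside an ambient algebra *)

Section SubBimodule.
Variables (k : comPzRingType) (R S C : nuAlgType k).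

(** R and S act through algebra maps into one algebra C, so that the bimodule
    laws are instances of associativity and distributivity of C.  The two
    modules of a corner context are both of this kind. *)
Record subbimodule := SubBimodule {
  sb_left : {linear R -> C};
  sb_right : {linear S -> C};
  sb_carrier : set C;
  sb_leftM : forall a b, sb_left (a ** b) = sb_left a ** sb_left b;
  sb_rightM : forall a b, sb_right (a ** b) = sb_right a ** sb_right b;
  sb_linear : linear_set sb_carrier;
  sb_lmul : forall a x, sb_carrier x -> sb_carrier (sb_left a ** x);
  sb_rmul : forall x b, sb_carrier x -> sb_carrier (x ** sb_right b)
}.

Variable D : subbimodule.

Definition sb_pred : {pred C} := fun x => `[< sb_carrier D x >].

Lemma sb_pred_submod : submod_closed sb_pred.
Proof.
split=> [|c x y /asboolP Dx /asboolP Dy]; apply/asboolP.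
  exact: (sb_linear D).1.
exact: (sb_linear D).2.
Qed.

HB.instance Definition _ :=
  GRing.isSubmodClosed.Build k C sb_pred sb_pred_submod.

Record sb_mod := SbMod { sb_val : C; _ : sb_val \in sb_pred }.

HB.instance Definition _ := [isSub for sb_val].
HB.instance Definition _ := [Choice of sb_mod by <:].
HB.instance Definition _ := [SubChoice_isSubLmodule of sb_mod by <:].

Lemma sb_valP (x : sb_mod) : sb_carrier D (sb_val x).
Proof. by have /asboolP := valP x. Qed.

Definition sb_mk c (Dc : sb_carrier D c) : sb_mod :=
  SbMod (introT (asboolP _) Dc).

Lemma sb_val_inj : injective sb_val.
Proof. exact: val_inj. Qed.

Lemma sb_val_is_linear : linear sb_val.
Proof. by []. Qed.

HB.instance Definition _ :=
  GRing.isLinear.Build k sb_mod C *:%R sb_val sb_val_is_linear.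

Definition sb_lact (a : R) (x : sb_mod) : sb_mod :=
  sb_mk (sb_lmul a (sb_valP x)).
Definition sb_ract (x : sb_mod) (b : S) : sb_mod :=
  sb_mk (sb_rmul b (sb_valP x)).

Fact sb_lactDl a b x : sb_lact (a + b) x = sb_lact a x + sb_lact b x.
Proof. by apply: sb_val_inj; rewrite /= linearD amulDl. Qed.
Fact sb_lactDr a x y : sb_lact a (x + y) = sb_lact a x + sb_lact a y.
Proof. by apply: sb_val_inj; rewrite /= amulDr. Qed.
Fact sb_lactZl c a x : sb_lact (c *: a) x = c *: sb_lact a x.
Proof. by apply: sb_val_inj; rewrite /= linearZ amulZl. Qed.
Fact sb_lactZr c a x : sb_lact a (c *: x) = c *: sb_lact a x.
Proof. by apply: sb_val_inj; rewrite /= amulZr. Qed.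
Fact sb_lactM a b x : sb_lact (a ** b) x = sb_lact a (sb_lact b x).
Proof. by apply: sb_val_inj; rewrite /= sb_leftM amulA. Qed.
Fact sb_ractDl x y b : sb_ract (x + y) b = sb_ract x b + sb_ract y b.
Proof. by apply: sb_val_inj; rewrite /= amulDl. Qed.
Fact sb_ractDr x a b : sb_ract x (a + b) = sb_ract x a + sb_ract x b.
Proof. by apply: sb_val_inj; rewrite /= linearD amulDr. Qed.
Fact sb_ractZl c x b : sb_ract (c *: x) b = c *: sb_ract x b.
Proof. by apply: sb_val_inj; rewrite /= amulZl. Qed.
Fact sb_ractZr c x b : sb_ract x (c *: b) = c *: sb_ract x b.
Proof. by apply: sb_val_inj; rewrite /= linearZ amulZr. Qed.
Fact sb_ractM x a b : sb_ract x (a ** b) = sb_ract (sb_ract x a) b.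
Proof. by apply: sb_val_inj; rewrite /= sb_rightM amulA. Qed.
Fact sb_lractA a x b : sb_ract (sb_lact a x) b = sb_lact a (sb_ract x b).
Proof. by apply: sb_val_inj; rewrite /= amulA. Qed.

HB.instance Definition _ := Lmodule_isBimodule.Build k R S sb_mod
  sb_lactDl sb_lactDr sb_lactZl sb_lactZr sb_lactM
  sb_ractDl sb_ractDr sb_ractZl sb_ractZr sb_ractM sb_lractA.

Lemma sb_val_lact (a : R) (x : sb_mod) :
  sb_val (a *> x) = sb_left D a ** sb_val x.
Proof. by []. Qed.

Lemma sb_val_ract (x : sb_mod) (b : S) :
  sb_val (x <* b) = sb_val x ** sb_right D b.
Proof. by []. Qed.

Lemma sb_val_image (U : set C) :
  sb_val @` (sb_val @^-1` U) = sb_carrier D `&` U.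
Proof.
apply/seteqP; split=> [_ [x Ux <-]|c [Dc Uc]].
  by split; [exact: sb_valP | exact: Ux].
by exists (sb_mk Dc).
Qed.

(** Spans of actions become products of subspaces of C, where associativity of
    [mulset] is available; with injectivity of [sb_val] this moves every
    unitality condition into C. *)
Lemma sb_lact_image (E : set R) (W : set sb_mod) :
  sb_val @` kspan [set a *> x | a in E & x in W] =
  (sb_left D @` E) `** (sb_val @` W).
Proof.
rewrite image_kspan; congr kspan; apply/seteqP; split=> z.
  by move=> [_ [a Ea [x Wx <-]] <-]; exists (sb_left D a);
    [exists a | exists (sb_val x); [exists x|]].
move=> [_ [a Ea <-] [_ [x Wx <-] <-]].
by exists (a *> x) => //; exists a => //; exists x.
Qed.

Lemma sb_ract_image (E : set S) (W : set sb_mod) :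
  sb_val @` kspan [set x <* b | x in W & b in E] =
  (sb_val @` W) `** (sb_right D @` E).
Proof.
rewrite image_kspan; congr kspan; apply/seteqP; split=> z.
  by move=> [_ [x Wx [b Eb <-]] <-]; exists (sb_val x);
    [exists x | exists (sb_right D b); [exists b|]].
move=> [_ [x Wx <-] [_ [b Eb <-] <-]].
by exists (x <* b) => //; exists x => //; exists b.
Qed.

End SubBimodule.

Section GradedSubspace.
Variables (k : comPzRingType) (G : groupType) (R S : nuAlgType k).
Variables (C : gradedAlgType k G) (D : subbimodule R S C).

(** A subspace that contains the components of its elements inherits the
    grading; uniqueness of the decomposition is inherited from C. *)
Lemma sb_direct :
  (forall c, sb_carrier D c -> forall t, sb_carrier D (hcomp c t)) ->
  direct_sum (fun t : G => @sb_val _ _ _ _ D @^-1` homog C t).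
Proof.
move=> Dcomp; split=> [t|x].
  by apply: linear_preimage; apply: homog_linear.
have [fx hx xE] := hcompP (sb_val x).
pose F t := sb_mk (Dcomp _ (sb_valP x) t).
have fF : fin_supp F.
  apply: sub_finite_set fx => t /=; apply: contraNN => /eqP xt.
  by apply/eqP/sb_val_inj.
exists F; split.
  by split=> //; apply: sb_val_inj; rewrite linear_fsumE.
move=> H [fH hH xH]; apply/funext => t; apply: sb_val_inj => /=.
have fH' : fin_supp (fun u => sb_val (H u)).
  apply: sub_finite_set fH => u /=; apply: contraNN => /eqP ->.
  by rewrite linear0.
rewrite (hcomp_unique fH' hH) // xH.
exact: linear_fsumE.
Qed.

End GradedSubspace.

(** * Graded Morita context of a full corner *)

Section Corner.
Variables (k : comPzRingType) (G : groupType) (A C : gradedAlgType k G).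
Variables (iota : {linear A -> C}) (X Y : set C).

Local Notation X_ t := (X `&` homog C t).
Local Notation Y_ t := (Y `&` homog C t).
Local Notation P t := (iota @` homog A t).

Hypothesis A_psg : partially_strongly_graded A.
Hypothesis iotaM : forall a b, iota (a ** b) = iota a ** iota b.
Hypothesis iota_inj : injective iota.
Hypothesis iota_homog : forall t a, homog C t (iota a) <-> homog A t a.
Hypothesis X_linear : linear_set X.
Hypothesis Y_linear : linear_set Y.
Hypothesis X_comp : forall x, X x -> forall t, X (hcomp x t).
Hypothesis Y_comp : forall y, Y y -> forall t, Y (hcomp y t).
Hypothesis X_ideal : forall x c, X x -> X (x ** c).
Hypothesis Y_ideal : forall c y, Y y -> Y (c ** y).
Hypothesis iotaXY : range iota = X `&` Y.
Hypothesis D_corner : forall t,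
  homog C t `** homog C t^-1%g `<=` Y_ t `** X_ t^-1%g.
Hypothesis XY_corner : forall t, X_ t `** Y_ t^-1%g `<=` P t `** P t^-1%g.
Hypothesis X_unital : forall t, X_ t `<=` P t `** P t^-1%g `** X_ t.
Hypothesis Y_unital : forall t, Y_ t `<=` Y_ t `** (P t^-1%g `** P t).
Hypothesis corner_full : [set: C] `<=` Y `** X.

Let iota_X a : X (iota a).
Proof. by have [] : (X `&` Y) (iota a) by rewrite -iotaXY; exists a. Qed.

Let iota_Y a : Y (iota a).
Proof. by have [] : (X `&` Y) (iota a) by rewrite -iotaXY; exists a. Qed.

Let P_X t : P t `<=` X_ t.
Proof. by move=> _ [a ha <-]; split=> //; apply/iota_homog. Qed.

Let P_Y t : P t `<=` Y_ t.
Proof. by move=> _ [a ha <-]; split=> //; apply/iota_homog. Qed.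

Let X_linear_ t : linear_set (X_ t).
Proof. by apply: linear_setI => //; apply: homog_linear. Qed.

Let Y_linear_ t : linear_set (Y_ t).
Proof. by apply: linear_setI => //; apply: homog_linear. Qed.

Let DCE t : Dideal C t = Y_ t `** X_ t^-1%g.
Proof.
apply/seteqP; split; first exact: D_corner.
by apply: mulsetS => c [].
Qed.

Let DAE t : iota @` Dideal A t = X_ t `** Y_ t^-1%g.
Proof.
rewrite image_mulset //; apply/seteqP; split; last exact: XY_corner.
by apply: mulsetS; [exact: P_X | exact: P_Y].
Qed.

Let DX t : (iota @` Dideal A t) `** X_ t = X_ t.
Proof.
apply/seteqP; split; last by rewrite image_mulset.
apply: mulset_sub => // _ x [a Da <-] [Xx hx]; split; first exact: X_ideal.
suff ha : homog A 1%g a.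
  by rewrite -[t]mul1g; apply: homogM => //; apply/iota_homog.
apply: mulset_sub Da; first exact: homog_linear.
by move=> u v hu hv; rewrite -(mulgV t); apply: homogM.
Qed.

Let YD t : Y_ t `** (iota @` Dideal A t^-1%g) = Y_ t.
Proof.
apply/seteqP; split; last by rewrite image_mulset // invgK.
apply: mulset_sub => // y _ [Yy hy] [a Da <-]; split; first exact: Y_ideal.
suff ha : homog A 1%g a.
  by rewrite -[t]mulg1; apply: homogM => //; apply/iota_homog.
apply: mulset_sub Da; first exact: homog_linear.
by move=> u v hu hv; rewrite -(mulgV t^-1)%g; apply: homogM.
Qed.

(* X_t (Y_{t^-1} X_t) = (X_t Y_{t^-1}) X_t = D^A_t X_t *)
Let XDC t : X_ t `** Dideal C t^-1%g = X_ t.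
Proof. by rewrite DCE mulsetA -DAE invgK DX. Qed.

(* (Y_t X_{t^-1}) Y_t = Y_t (X_{t^-1} Y_t) = Y_t D^A_{t^-1} *)
Let DCY t : Dideal C t `** Y_ t = Y_ t.
Proof.
rewrite DCE -mulsetA; have := DAE t^-1%g; rewrite invgK => <-.
exact: YD.
Qed.

Let DA_idem t : idempotent_set (Dideal A t).
Proof. by rewrite /idempotent_set /Dideal mulsetA -A_psg. Qed.

Let DC_idem t : idempotent_set (Dideal C t).
Proof. by rewrite /idempotent_set {2}DCE mulsetA DCY -DCE. Qed.

Let A_fact a t : homog A t a -> (homog A t `** homog A 1%g) a.
Proof.
rewrite {1}A_psg -mulsetA; apply: mulsetS => //.
apply: mulset_sub => [|u v hu hv]; first exact: homog_linear.
by rewrite -(mulVg t); apply: homogM.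
Qed.

Let A_idem : idempotent_set [set: A].
Proof.
apply/seteqP; split=> // a _; apply: homog_ind => [|t].
  exact: mulset_linear.
by have [_ /(_ t) /A_fact h _] := hcompP a; apply: mulsetS h.
Qed.

Let C_idem : idempotent_set [set: C].
Proof.
apply/seteqP; split=> // c _.
by have := @corner_full c I; apply: mulsetS.
Qed.

Definition corner_X : subbimodule A C C :=
  @SubBimodule _ _ _ _ iota idfun X iotaM (fun _ _ => erefl) X_linear
    (fun a x _ => X_ideal x (iota_X a)) (fun x c Xx => X_ideal c Xx).

Definition corner_Y : subbimodule C A C :=
  @SubBimodule _ _ _ _ idfun iota Y (fun _ _ => erefl) iotaM Y_linear
    (fun c y Yy => Y_ideal c Yy) (fun y a _ => Y_ideal y (iota_Y a)).

Local Notation XM := (sb_mod corner_X).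
Local Notation YM := (sb_mod corner_Y).

Let X_val (x : XM) : X (sb_val x). Proof. exact: (sb_valP x). Qed.

Let Y_val (y : YM) : Y (sb_val y). Proof. exact: (sb_valP y). Qed.

Let mkX c (Xc : X c) : XM := @sb_mk _ _ _ _ corner_X c Xc.

Let mkY c (Yc : Y c) : YM := @sb_mk _ _ _ _ corner_Y c Yc.

(* A product x y lies in the row and in the column, hence in the image of
   iota; injectivity makes its preimage bilinear and balanced in x and y. *)
Let tauA_ex : exists F : {linear tensor XM YM -> A},
  forall x y, iota (F (x \ox y)) = sb_val x ** sb_val y.
Proof.
have xyP (x : XM) (y : YM) : {a | iota a = sb_val x ** sb_val y}.
  apply: cid; have : (X `&` Y) (sb_val x ** sb_val y).
    by split; [exact: X_ideal | exact: Y_ideal].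
  by rewrite -iotaXY => -[a _ <-]; exists a.
pose phi x y := sval (xyP x y).
have phiE x y : iota (phi x y) = sb_val x ** sb_val y := svalP (xyP x y).
have [F FE] : exists F : {linear tensor XM YM -> A},
    forall x y, F (x \ox y) = phi x y.
  apply: tensor_lift => *; apply: iota_inj.
  - by rewrite linearD !phiE /= amulDl.
  - by rewrite linearD !phiE /= amulDr.
  - by rewrite linearZ !phiE /= amulZl.
  - by rewrite linearZ !phiE /= amulZr.
  - by rewrite !phiE /= amulA.
by exists F => x y; rewrite FE.
Qed.

Let tauC_ex : exists F : {linear tensor YM XM -> C},
  forall y x, F (y \ox x) = sb_val y ** sb_val x.
Proof.
apply: (tensor_lift (phi := fun (y : YM) (x : XM) => sb_val y ** sb_val x));
  move=> * /=; by rewrite ?amulDl ?amulDr ?amulZl ?amulZr ?amulA.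
Qed.

(** Through iota, the pairing X (x) Y -> A is multiplication in C, as is the
    pairing Y (x) X -> C.  Every identity of the Morita context may therefore
    be checked in C, after applying iota or the inclusions of X and Y. *)
Lemma corner_equivalence : strongly_graded_equivalent A C.
Proof.
split=> //.
have [FA FAE] := tauA_ex; have [FC FCE] := tauC_ex.
have FAl a x y : FA ((a *> x) \ox y) = a ** FA (x \ox y).
  by apply: iota_inj; rewrite iotaM !FAE amulA.
have FAr x y a : FA (x \ox (y <* a)) = FA (x \ox y) ** a.
  by apply: iota_inj; rewrite iotaM !FAE amulA.
have FCl c y x : FC ((c *> y) \ox x) = c ** FC (y \ox x).
  by rewrite !FCE amulA.
have FCr y x c : FC (y \ox (x <* c)) = FC (y \ox x) ** c.
  by rewrite !FCE amulA.
have FAC x y x' : FA (x \ox y) *> x' = x <* FC (y \ox x').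
  by apply: sb_val_inj; rewrite sb_val_lact sb_val_ract /= FAE FCE amulA.
have FCA y x y' : FC (y \ox x) *> y' = y <* FA (x \ox y').
  by apply: sb_val_inj; rewrite sb_val_lact sb_val_ract /= FAE FCE amulA.
pose M : morita_context A C := MoritaContext FAl FAr FCl FCr FAC FCA.
exists M, (fun t => @sb_val _ _ _ _ corner_X @^-1` homog C t),
  (fun t => @sb_val _ _ _ _ corner_Y @^-1` homog C t).
split=> [|a|c|t|t].
- split.
    split; [split|split| |].
    + exact: sb_direct.
    + move=> s t a x ha hx.
      by apply: homogM => //; apply/iota_homog.
    + by move=> s t x c hx hc; apply: homogM.
    + exact: sb_direct.
    + by move=> s t c y hc hy; apply: homogM.
    + move=> s t y a hy ha.
      by apply: homogM => //; apply/iota_homog.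
    + move=> r s x y hx hy; apply/iota_homog; rewrite FAE.
      exact: homogM.
    + by move=> r s y x hy hx; rewrite FCE; apply: homogM.
  move=> t; split; split; apply: (image_inj_eq (@sb_val_inj _ _ _ _ _)).
  + by rewrite sb_lact_image sb_val_image; apply: DX.
  + by rewrite sb_ract_image sb_val_image image_id; apply: XDC.
  + by rewrite sb_lact_image sb_val_image image_id; apply: DCY.
  + by rewrite sb_ract_image sb_val_image; apply: YD.
- suff : range FA a by case=> z _ <-; exists z.
  have : (setT `** setT) a by rewrite A_idem.
  apply: mulset_sub => [|u v _ _]; first exact: linear_range.
  exists (mkX (iota_X u) \ox mkY (iota_Y v)) => //.
  by apply: iota_inj; rewrite FAE iotaM.
- suff : range FC c by case=> z _ <-; exists z.
  apply: mulset_sub (@corner_full c I); first exact: linear_range.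
  by move=> y x Yy Xx; exists (mkY Yy \ox mkX Xx); rewrite ?FCE.
- apply: (image_inj_eq iota_inj); rewrite image_kspan DAE.
  congr kspan; apply/seteqP; split=> z.
    move=> [_ [x hx [y hy <-]] <-]; exists (sb_val x).
      by split.
    by exists (sb_val y); [split | rewrite FAE].
  move=> [x [Xx hx] [y [Yy hy] <-]].
  exists (FA (mkX Xx \ox mkY Yy)); last by rewrite FAE.
  by exists (mkX Xx) => //; exists (mkY Yy).
- rewrite DCE; congr kspan; apply/seteqP; split=> z.
    move=> [y hy [x hx <-]]; exists (sb_val y).
      by split.
    by exists (sb_val x); [split | rewrite FCE].
  move=> [y [Yy hy] [x [Xx hx] <-]].
  by exists (mkY Yy) => //; exists (mkX Xx) => //; rewrite FCE.
Qed.

End Corner.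

(** * The partial skew group algebra as a matrix algebra *)

Section SkewMatrices.
Variables (k : comPzRingType) (G : groupType) (B : gradedAlgType k G).
Hypothesis B_psg : partially_strongly_graded B.

Local Notation B_ t := (homog B t%g).
Local Notation C := (partial_skew_algebra B).

Lemma homog_mulset (s t : G) : B_ s `** B_ t `<=` B_ (s * t).
Proof.
by apply: mulset_sub => [|x y hx hy]; [exact: homog_linear | exact: homogM].
Qed.

(** B_1 acts as a unit on products of components because
    B_t = B_t (B_{t^-1} B_t) with B_{t^-1} B_t inside B_1. *)
Lemma homog_mulset1r (t : G) : B_ t `** B_ 1 = B_ t.
Proof.
apply/seteqP; split; first by rewrite -{2}[t]mulg1; apply: homog_mulset.
rewrite {1}B_psg -mulsetA; apply: mulsetS => //.
by rewrite -(mulVg t); apply: homog_mulset.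
Qed.

Lemma homog_mulset1l (t : G) : B_ 1 `** B_ t = B_ t.
Proof.
apply/seteqP; split; first by rewrite -{2}[t]mul1g; apply: homog_mulset.
rewrite {1}B_psg; apply: mulsetS => //.
by rewrite -(mulgV t); apply: homog_mulset.
Qed.

(** The position (r,u) of the degree t part of the matrix algebra: the
    coefficients b of b e_{r,tu} delta_t. *)
Definition entry (t r u : G) : set B := B_ r^-1 `** B_ t `** B_ u.

Lemma entry_linear t r u : linear_set (entry t r u).
Proof. exact: mulset_linear. Qed.

Lemma entry_ind (T : set B) t r u : linear_set T ->
  (forall b1 b2 b3, B_ r^-1 b1 -> B_ t b2 -> B_ u b3 -> T (b1 ** b2 ** b3)) ->
  entry t r u `<=` T.
Proof.
move=> lT Tb; apply: mulset_sub => // x z xD hz; move: x xD.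
apply: (mulset_sub (linear_rmul z lT)) => x y hx hy; exact: Tb.
Qed.

Lemma mem_entry t r u b1 b2 b3 : B_ r^-1 b1 -> B_ t b2 -> B_ u b3 ->
  entry t r u (b1 ** b2 ** b3).
Proof. by move=> h1 h2 h3; do 2?apply: mem_mulset. Qed.

Lemma entry_homog t r u : entry t r u `<=` B_ (r^-1 * (t * u)).
Proof.
apply: entry_ind => [|b1 b2 b3 h1 h2 h3]; first exact: homog_linear.
by rewrite mulgA; apply: homogM => //; apply: homogM.
Qed.

(** The inner factors B_u B_{u^-1} land in B_1 and are absorbed into B_t. *)
Lemma entryM s t r u v b c : entry s r u b -> entry t u v c ->
  entry (s * t)%g r v (b ** c).
Proof.
move=> hb hc; move: b hb; apply: entry_ind => [|b1 b2 b3 h1 h2 h3].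
  exact/linear_rmul/entry_linear.
move: c hc; apply: entry_ind => [|c1 c2 c3 k1 k2 k3].
  exact/linear_lmul/entry_linear.
rewrite -!amulA (amulA b3) (amulA (b3 ** c1)) (amulA b2) amulA.
apply: mem_entry => //; apply: homogM => //.
rewrite -[t]mul1g -(mulgV u); apply: homogM => //; exact: homogM.
Qed.

Lemma entry_row1 t u : entry t 1%g u = B_ t `** B_ u.
Proof. by rewrite /entry invg1 homog_mulset1l. Qed.

Lemma entry_col1 t r : entry t r 1%g = B_ r^-1 `** B_ t.
Proof. by rewrite /entry -mulsetA homog_mulset1r. Qed.

Lemma entry11 t : entry t 1%g 1%g = B_ t.
Proof. by rewrite entry_row1 homog_mulset1r. Qed.

(** This is b e_{r,s}; it is made total by returning 0 when b does not have
    degree r^-1 s, which spares a proof argument. *)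
Definition munit (r s : G) (b : B) : smash B :=
  insubd (0 : smash B) (fun p => if p == (r, s) then b else 0).

Lemma munitE r s b p : B_ (r^-1 * s) b ->
  munit r s b p = if p == (r, s) then b else 0.
Proof.
move=> hb.
have bP : (fun p => if p == (r, s) then b else 0) \in @smash_pred _ _ B.
  apply/asboolP; split=> [|r' s'].
    apply: (sub_finite_set _ (finite_set1 (r, s))) => q /=.
    by case: (eqVneq q (r, s)) => // _; rewrite eqxx.
  by case: eqVneq => [[-> ->]//|_]; exact: (homog_linear _ _).1.
by rewrite -[LHS]/(val (munit r s b) p) val_insubd bP.
Qed.

Lemma munit_linear r s c a b : B_ (r^-1 * s) a -> B_ (r^-1 * s) b ->
  munit r s (c *: a + b) = c *: munit r s a + munit r s b.
Proof.
move=> ha hb; apply: smashP => r' s'.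
rewrite smashD smashZ !munitE //; last exact: (homog_linear _ _).2.
by case: ifP; rewrite // scaler0 addr0.
Qed.

Lemma munitM r s s' u b c : B_ (r^-1 * s) b -> B_ (s'^-1 * u) c ->
  munit r s b ** munit s' u c = if s == s' then munit r u (b ** c) else 0.
Proof.
move=> hb hc; apply: smashP => p q.
rewrite smashM (@fsum_seq _ _ _ _ [:: s]) //.
  rewrite big_cons big_nil addr0 !munitE // !xpair_eqE eqxx andbT.
  case: (eqVneq s s') hc => [<-|_] hc; last by rewrite /= amul0r.
  have hbc : B_ (r^-1 * u) (b ** c).
    by have := homogM _ _ _ _ hb hc; rewrite -mulgA mulVKg.
  rewrite munitE // xpair_eqE.
  by case: (p == r); case: (q == u); rewrite /= ?amul0l ?amul0r.
move=> w; rewrite inE => /negPf ws.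
by rewrite munitE // xpair_eqE ws andbF amul0l.
Qed.

Lemma beta_munit t r s b : B_ (r^-1 * s) b ->
  beta t (munit r s b) = munit (t * r)%g (t * s)%g b.
Proof.
move=> hb; apply: smashP => p q; rewrite betaE !munitE //; last first.
  by rewrite invgM -mulgA mulKg.
by rewrite !xpair_eqE !(can2_eq (mulVKg t) (mulKg t)).
Qed.

(** The (r,s) entry of a product from I beta_t(I) sums products from
    (B_{r^-1} B_w) (B_{w^-1 t} B_{t^-1 s}), whose two middle factors multiply
    into B_t. *)
Lemma psmash_dom_entry t f : psmash_dom t f ->
  forall r s, entry t r (t^-1 * s)%g (f (r, s)).
Proof.
move=> Df r s; move: f Df; apply: (@mulset_sub _ _ _ _ 
    [set f : smash B | entry t r (t^-1 * s)%g (f (r, s))]).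
  split=> [|c f g hf hg] /=; first exact: (entry_linear _ _ _).1.
  exact: (entry_linear _ _ _).2.
move=> f _ If [g Ig <-]; rewrite /mkset smashM.
apply: linear_fsum => [|w]; first exact: entry_linear.
rewrite betaE; move: (f _) (If r w) => b hb.
move: (g _) (Ig (t^-1 * w)%g (t^-1 * s)%g) => c hc.
move: b hb.
apply: (mulset_sub (linear_rmul _ (entry_linear _ _ _))) => b1 b2 h1 h2 /=.
move: c hc.
apply: (mulset_sub (linear_lmul _ (entry_linear _ _ _))) => c1 c2 k1 k2 /=.
rewrite -amulA (amulA b2) amulA; apply: mem_entry => //.
have -> : t = (w * (t^-1 * w)^-1)%g by rewrite invgM invgK mulgA mulgV mul1g.
exact: homogM.
Qed.

Lemma munit_psmash r s b : (B_ r^-1 `** B_ s) b -> psmash (munit r s b).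
Proof.
move=> hb r' s'; rewrite munitE; last exact: homog_mulset hb.
by case: eqVneq => [[-> ->]//|_]; exact: (mulset_linear _ _).1.
Qed.

Lemma munit_preimage_linear r s (T : set (smash B)) : linear_set T ->
  linear_set (B_ (r^-1 * s) `&` [set b | T (munit r s b)]).
Proof.
move=> [T0 Tl]; split=> [|c a b [ha Ta] [hb Tb]].
  have h0 := (homog_linear B (r^-1 * s)%g).1; split=> //=.
  rewrite (_ : munit r s 0 = 0) //.
  by apply: smashP => p q; rewrite munitE ?if_same.
split; first exact: (homog_linear _ _).2.
by rewrite /= munit_linear //; apply: Tl.
Qed.

(** Splitting B_t as B_t B_1 factors b e_{r,tu} through the index t, as an
    element of B_{r^-1} B_t e_{r,t} in I times beta_t of an element of
    B_1 B_u e_{1,u} in I. *)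
Lemma munit_psmash_dom t r u b : entry t r u b ->
  psmash_dom t (munit r (t * u)%g b).
Proof.
pose T := B_ (r^-1 * (t * u)) `&` [set b | psmash_dom t (munit r (t * u)%g b)].
have lT : linear_set T.
  by apply: munit_preimage_linear; apply: mulset_linear.
suff sub : entry t r u `<=` T by move=> /sub[].
apply: entry_ind => // b1 b2 b3 h1 h2 h3.
move: b2 h2; rewrite -homog_mulset1r.
apply: (mulset_sub (linear_lmul b1 (linear_rmul b3 lT))) => c1 c2 k1 k2 /=.
split.
  apply: entry_homog; apply: mem_entry => //.
  by rewrite -homog_mulset1r; apply: mem_mulset.
rewrite /mkset.
have hl : (B_ r^-1 `** B_ t) (b1 ** c1) by apply: mem_mulset.
have hr : (B_ 1^-1 `** B_ u) (c2 ** b3) by rewrite invg1; apply: mem_mulset.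
have -> : munit r (t * u)%g (b1 ** (c1 ** c2) ** b3) =
  munit r t (b1 ** c1) ** beta t (munit 1%g u (c2 ** b3)).
  rewrite beta_munit; last exact: homog_mulset hr.
  rewrite mulg1 munitM ?eqxx.
  - by rewrite !amulA.
  - exact: homog_mulset hl.
  - by rewrite mulKg; have := homog_mulset hr; rewrite invg1 mul1g.
apply: mem_mulset; first exact: munit_psmash.
by exists (munit 1%g u (c2 ** b3)) => //; apply: munit_psmash.
Qed.

Lemma smash_sumE (J : Type) (q : seq J) (F : J -> smash B) p :
  (\sum_(j <- q) F j) p = \sum_(j <- q) F j p.
Proof. by elim: q => [|j q IH]; rewrite ?big_nil // !big_cons -IH. Qed.

(** This is b e_{r,tu} delta_t, or 0 when b is not in [entry t r u].  The
    column of the underlying smash matrix is shifted by t so that products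
    below match on the label u. *)
Definition elt (t r u : G) (b : B) : C :=
  insubd (0 : C) (fun v => if v == t then munit r (t * u)%g b else 0).

Lemma eltE t r u b v : entry t r u b ->
  elt t r u b v = if v == t then munit r (t * u)%g b else 0.
Proof.
move=> hb; have bP : (fun v => if v == t then munit r (t * u)%g b else 0)
    \in @skew_pred _ _ B.
  apply/asboolP; split=> [|s].
    apply: (sub_finite_set _ (finite_set1 t)) => s /=.
    by case: (eqVneq s t) => // _; rewrite eqxx.
  case: eqVneq => [->|_]; first exact: munit_psmash_dom.
  exact: (mulset_linear _ _).1.
by rewrite -[LHS]/(val (elt t r u b) v) val_insubd bP.
Qed.

Lemma eltEE t r u b v p : entry t r u b ->
  elt t r u b v p = if (v == t) && (p == (r, t * u)%g) then b else 0.
Proof.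
move=> hb; rewrite eltE //; case: eqP => //= _.
by rewrite munitE //; apply: entry_homog.
Qed.

Lemma elt0 t r u : elt t r u 0 = 0.
Proof.
have h0 := (entry_linear t r u).1.
by apply: skewP => v; apply: smashP => p q; rewrite eltEE // if_same.
Qed.

Lemma elt_preimage_linear t r u (T : set C) : linear_set T ->
  linear_set (entry t r u `&` [set b | T (elt t r u b)]).
Proof.
move=> [T0 Tl]; split=> [|c a b [ha Ta] [hb Tb]].
  by split; [exact: (entry_linear _ _ _).1 | rewrite /= elt0].
have hab := (entry_linear t r u).2 c _ _ ha hb; split=> //=.
rewrite (_ : elt _ _ _ _ = c *: elt t r u a + elt t r u b); first exact: Tl.
apply: skewP => v; apply: smashP => p q.
rewrite skewD skewZ smashD smashZ !eltEE //.
by case: ifP => // _; rewrite scaler0 addr0.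
Qed.

(** beta_s moves the row u' of the second factor to s u', to be compared with
    the column s u of the first: with the shifted column label, elements
    multiply as matrix units. *)
Lemma eltM s t r u u' v b c : entry s r u b -> entry t u' v c ->
  elt s r u b ** elt t u' v c =
  if u == u' then elt (s * t)%g r v (b ** c) else 0.
Proof.
move=> hb hc; apply: skewP => w.
rewrite -[LHS]/(skew_mul_fun _ _ w).
rewrite (@skew_mul_seq _ _ _ _ _ [:: s]) //; last first.
  by move=> x; rewrite inE eltE // => /negPf ->.
rewrite big_cons big_nil addr0 !eltE // eqxx.
have -> : (s^-1 * w == t)%g = (w == s * t)%g.
  by rewrite (can2_eq (mulVKg s) (mulKg s)).
have [->|wst] := eqVneq w (s * t)%g; last first.
  rewrite linear0 amul0r; case: eqP hc => // <- hc.
  by rewrite eltE ?(negPf wst) //; apply: entryM hc.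
rewrite beta_munit; last exact: entry_homog.
rewrite munitM; first last.
- by rewrite invgM -mulgA mulKg; apply: entry_homog.
- exact: entry_homog.
rewrite (inj_eq (mulgI s)); case: (eqVneq u u') hc => // <- hc.
by rewrite eltE ?eqxx ?mulgA //; apply: entryM hc.
Qed.

Lemma elt_homog t r u b : entry t r u b -> homog C t (elt t r u b).
Proof. by move=> hb s /negPf st; rewrite eltE // st. Qed.

(** Linear properties of C_t need only be tested at matrix units carrying a
    product b1 b2 b3, at the positions where f does not vanish; the latter
    proviso lets one induction principle serve C_t, its first row and its
    first column. *)
Lemma homog_elt_ind (T : set C) t f : linear_set T -> homog C t f ->
  (forall r u, f t (r, t * u)%g != 0 -> forall b1 b2 b3,
    B_ r^-1 b1 -> B_ t b2 -> B_ u b3 -> T (elt t r u (b1 ** b2 ** b3))) ->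
  T f.
Proof.
move=> lT hf Tb; have [q [uq q0]] := fin_supp_seq (smash_supp (f t)).
have ftE p : entry t p.1 (t^-1 * p.2)%g (f t p).
  by case: p => r s; apply: psmash_dom_entry; apply: skew_dom.
have -> : f = \sum_(p <- q) elt t p.1 (t^-1 * p.2)%g (f t p).
  apply: skewP => v; rewrite skew_sumE; apply: smashP => r s.
  rewrite smash_sumE.
  under eq_bigr do rewrite eltEE // mulVKg -surjective_pairing.
  have [->|vt] := eqVneq v t; last by rewrite hf // big1.
  have [rs|rs] := boolP ((r, s) \in q).
    rewrite (bigD1_seq (r, s)) //= eqxx big1 ?addr0 // => i /negPf.
    by rewrite eq_sym => ->.
  rewrite q0 // big1_seq // => i /andP[_ iq].
  by case: eqP => // irs; rewrite irs iq in rs.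
apply: linear_set_sum => // -[r s] _ /=.
have [->|nz] := eqVneq (f t (r, s)) 0; first by rewrite elt0; apply: lT.1.
set u := (t^-1 * s)%g.
suff sub : entry t r u `<=` entry t r u `&` [set b | T (elt t r u b)].
  by have [] := sub _ (ftE (r, s)).
apply: entry_ind => [|b1 b2 b3 h1 h2 h3]; first exact: elt_preimage_linear.
split; first exact: mem_entry.
by apply: Tb => //; rewrite mulVKg.
Qed.

(** The first row and first column of the matrix algebra.  Column label 1 in
    degree t is column t of the underlying smash matrix. *)
Definition row1 : set C :=
  [set f : C | forall t r s : G, r != 1%g -> f t (r, s) = 0].
Definition col1 : set C :=
  [set f : C | forall t r s : G, s != t -> f t (r, s) = 0].

Lemma row1_linear : linear_set row1.
Proof.
split=> [//|c f g hf hg t r s r1].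
by rewrite skewD skewZ smashD smashZ hf // hg // scaler0 addr0.
Qed.

Lemma col1_linear : linear_set col1.
Proof.
split=> [//|c f g hf hg t r s st].
by rewrite skewD skewZ smashD smashZ hf // hg // scaler0 addr0.
Qed.

Lemma elt_row1 t u b : entry t 1%g u b -> row1 (elt t 1%g u b).
Proof.
by move=> hb v r s /negPf r1; rewrite eltEE // xpair_eqE r1 andbF.
Qed.

Lemma elt_col1 t r b : entry t r 1%g b -> col1 (elt t r 1%g b).
Proof.
move=> hb v r' s vs; rewrite eltEE // xpair_eqE mulg1.
by case: (eqVneq v t) vs => //= -> /negPf ->; rewrite andbF.
Qed.

Lemma skewM_eq0 (f g : C) t r s :
  (forall v w, f v (r, w) = 0 \/ g (v^-1 * t)%g (v^-1 * w, v^-1 * s)%g = 0) ->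
  (f ** g) t (r, s) = 0.
Proof.
move=> fg0; have [q [uq q0]] := fin_supp_seq (skew_supp f).
rewrite -[(f ** g) t]/(skew_mul_fun f g t) (skew_mul_seq g t uq q0) smash_sumE.
rewrite big1 // => v _; rewrite smashM fsbig1 // => w _; rewrite betaE.
by case: (fg0 v w) => ->; rewrite ?amul0l ?amul0r.
Qed.

Lemma row1_ideal f g : row1 f -> row1 (f ** g).
Proof. by move=> hf t r s r1; apply: skewM_eq0 => v w; left; apply: hf. Qed.

Lemma col1_ideal f g : col1 g -> col1 (f ** g).
Proof.
move=> hg t r s st; apply: skewM_eq0 => v w; right; apply: hg.
by rewrite (inj_eq (mulgI _)).
Qed.

Lemma hcomp_skew (f : C) t v : hcomp f t v = if v == t then f t else 0.
Proof.
have [ff hf fE] := hcompP f.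
case: eqVneq => [->|vt]; last by rewrite (hf t).
have [q [uq q0]] := fin_supp_seq ff; rewrite [in RHS]fE (fsum_seq uq q0).
rewrite skew_sumE; have [tq|tq] := boolP (t \in q).
  rewrite (bigD1_seq t) //= big1 ?addr0 // => i it.
  by apply: (hf i); rewrite eq_sym.
rewrite q0 // big1_seq // => i /andP[_ iq]; apply: (hf i).
by apply: contraNneq tq => ->.
Qed.

Lemma row1_comp f : row1 f -> forall t, row1 (hcomp f t).
Proof.
by move=> hf t v r s r1; rewrite hcomp_skew; case: eqP => // _; apply: hf.
Qed.

Lemma col1_comp f : col1 f -> forall t, col1 (hcomp f t).
Proof.
move=> hf t v r s sv; rewrite hcomp_skew; case: eqP => // vt.
by apply: hf; rewrite -vt.
Qed.

(** The component of b in B_t = B_1 B_t B_1 is placed at position (1,1) of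
    degree t, that is at e_{1,t} delta_t. *)
Definition corner_fun (b : B) (t : G) : smash B := munit 1%g t (hcomp b t).

Lemma hcomp_deg b t : B_ t (hcomp b t).
Proof. by have [_ h _] := hcompP b; apply: h. Qed.

Lemma corner_funE b t p :
  corner_fun b t p = if p == (1%g, t) then hcomp b t else 0.
Proof. by rewrite /corner_fun munitE // invg1 mul1g; apply: hcomp_deg. Qed.

Lemma corner_subproof b : corner_fun b \in @skew_pred _ _ B.
Proof.
apply/asboolP; split=> [|t].
  have [fb _ _] := hcompP b; apply: sub_finite_set fb => t /=.
  apply: contraNN => /eqP bt; apply/eqP/smashP => r s.
  by rewrite corner_funE bt if_same.
have hb : entry t 1%g 1%g (hcomp b t) by rewrite entry11; apply: hcomp_deg.
by have := munit_psmash_dom hb; rewrite mulg1.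
Qed.

Definition corner_emb b : C := Skew (corner_subproof b).

Lemma corner_embE b t p :
  corner_emb b t p = if p == (1%g, t) then hcomp b t else 0.
Proof. exact: corner_funE. Qed.

Lemma corner_emb_linear : linear corner_emb.
Proof.
move=> c a b; apply: skewP => t; apply: smashP => r s.
rewrite skewD skewZ smashD smashZ !corner_embE hcomp_linear.
by case: ifP => // _; rewrite scaler0 addr0.
Qed.

HB.instance Definition _ :=
  GRing.isLinear.Build k B C *:%R corner_emb corner_emb_linear.

Lemma corner_emb_elt t b : B_ t b -> corner_emb b = elt t 1%g 1%g b.
Proof.
move=> hb; apply: skewP => v; apply: smashP => r s.
rewrite corner_embE eltEE ?entry11 // (hcomp_homog hb) mulg1.
by case: (eqVneq v t) => [->|_]; rewrite ?if_same.
Qed.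

Lemma corner_embM a b : corner_emb (a ** b) = corner_emb a ** corner_emb b.
Proof.
pose T := [set a | corner_emb (a ** b) = corner_emb a ** corner_emb b].
apply: (@homog_ind _ _ _ T) => [|s].
  split=> [|c x y]; rewrite /T /= ?amul0l ?linear0 ?amul0l // => hx hy.
  by rewrite amulDl amulZl !corner_emb_linear hx hy amulDl amulZl.
rewrite /T /=; move: (hcomp_deg a s); move: (hcomp a s) => {T}{}a ha.
pose T := [set b | corner_emb (a ** b) = corner_emb a ** corner_emb b].
apply: (@homog_ind _ _ _ T) => [|t].
  split=> [|c x y]; rewrite /T /= ?amul0r ?linear0 ?amul0r // => hx hy.
  by rewrite amulDr amulZr !corner_emb_linear hx hy amulDr amulZr.
rewrite /T /=; move: (hcomp_deg b t); move: (hcomp b t) => {T}{}b hb.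
rewrite (corner_emb_elt ha) (corner_emb_elt hb) eltM ?entry11 // eqxx.
by apply: corner_emb_elt; apply: homogM.
Qed.

Lemma corner_emb_inj : injective corner_emb.
Proof.
move=> a b ab; have hab : hcomp a = hcomp b.
  apply/funext => t; have := corner_embE a t (1%g, t).
  by rewrite ab corner_embE eqxx.
have [_ _ ->] := hcompP a; have [_ _ bE] := hcompP b.
by rewrite hab -bE.
Qed.

Lemma corner_emb_homog t a : homog C t (corner_emb a) <-> B_ t a.
Proof.
split=> [ha|ha]; last first.
  by rewrite (corner_emb_elt ha); apply: elt_homog; rewrite entry11.
apply: homog_ind => [|s]; first exact: homog_linear.
have [<-|st] := eqVneq s t; first exact: hcomp_deg.
have := corner_embE a s (1%g, s); rewrite (ha s st) eqxx => <-.
exact: (homog_linear _ _).1.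
Qed.

Lemma range_corner_emb : range corner_emb = row1 `&` col1.
Proof.
apply/seteqP; split=> [_ [b _ <-]|f [f1 f2]].
  split=> t r s h; rewrite corner_embE xpair_eqE.
    by rewrite (negPf h).
  by rewrite (negPf h) andbF.
apply: homog_ind => [|t]; first exact: linear_range.
have [_ /(_ t) hf _] := hcompP f.
apply: homog_elt_ind hf _ => [|r u]; first exact: linear_range.
have [->|r1] := eqVneq r 1%g; last by rewrite row1_comp ?eqxx.
have [->|u1] := eqVneq u 1%g; last first.
  rewrite col1_comp ?eqxx //; apply: contraNneq u1 => tu.
  by apply/eqP/(mulgI t); rewrite mulg1.
move=> _ b1 b2 b3 h1 h2 h3; exists (b1 ** b2 ** b3) => //.
by apply: corner_emb_elt; rewrite -entry11; apply: mem_entry.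
Qed.

Local Notation X_ t := (row1 `&` homog C t%g).
Local Notation Y_ t := (col1 `&` homog C t%g).
Local Notation P t := (corner_emb @` B_ t).

(** (b1 b2 b3) (c1 c2 c3) = (b1 b2) (b3 c1 c2 c3), where b3 c1 is in
    B_u B_{u^-1}, so that b3 c1 c2 has degree t^-1: the common index u is
    traded for 1. *)
Lemma skew_Dideal_sub t : homog C t `** homog C t^-1%g `<=` Y_ t `** X_ t^-1%g.
Proof.
have lYX := mulset_linear (Y_ t) (X_ t^-1%g).
apply: mulset_sub => // f g hf hg.
apply: (homog_elt_ind (linear_rmul g lYX) hf) => r u _ b1 b2 b3 h1 h2 h3.
apply: (homog_elt_ind (linear_lmul (elt t r u (b1 ** b2 ** b3)) lYX) hg)
  => u' v _ c1 c2 c3 k1 k2 k3.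
rewrite /mkset eltM; try exact: mem_entry.
case: (eqVneq u u') k1 => [<-|_] k1; last exact: lYX.1.
have hl : entry t r 1%g (b1 ** b2) by rewrite entry_col1; apply: mem_mulset.
have hr : entry t^-1%g 1%g v (b3 ** c1 ** c2 ** c3).
  rewrite entry_row1; apply: mem_mulset => //.
  by rewrite -[t^-1%g]mul1g -(mulgV u); do 2?apply: homogM.
have -> : elt (t * t^-1)%g r v (b1 ** b2 ** b3 ** (c1 ** c2 ** c3)) =
    elt t r 1%g (b1 ** b2) ** elt t^-1%g 1%g v (b3 ** c1 ** c2 ** c3).
  by rewrite eltM // eqxx !amulA.
apply: mem_mulset; split; first exact: elt_col1; first exact: elt_homog.
  exact: elt_row1.
exact: elt_homog.
Qed.

(** The regrouping of [skew_Dideal_sub], with outer labels equal to 1. *)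
Lemma row1_mul_col1 t : X_ t `** Y_ t^-1%g `<=` P t `** P t^-1%g.
Proof.
have lPP := mulset_linear (P t) (P t^-1%g).
apply: mulset_sub => // f g [f1 hf] [g1 hg].
apply: (homog_elt_ind (linear_rmul g lPP) hf) => r u.
have [->|r1] := eqVneq r 1%g; last by rewrite f1 ?eqxx.
move=> _ b1 b2 b3 h1 h2 h3.
apply: (homog_elt_ind (linear_lmul (elt t 1%g u (b1 ** b2 ** b3)) lPP) hg)
  => u' v.
have [->|v1] := eqVneq v 1%g; last first.
  rewrite g1 ?eqxx //; apply: contraNneq v1 => tv.
  by apply/eqP/(mulgI t^-1%g); rewrite mulg1.
move=> _ c1 c2 c3 k1 k2 k3.
rewrite /mkset eltM; try exact: mem_entry.
case: (eqVneq u u') k1 => [<-|_] k1; last exact: lPP.1.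
have hl : B_ t (b1 ** b2).
  by rewrite -[t]mul1g; apply: homogM => //; rewrite -invg1.
have hr : B_ t^-1 (b3 ** c1 ** c2 ** c3).
  suff : B_ (u * u^-1 * t^-1 * 1) (b3 ** c1 ** c2 ** c3).
    by rewrite mulgV mul1g mulg1.
  by do 3?apply: homogM.
have -> : elt (t * t^-1)%g 1%g 1%g (b1 ** b2 ** b3 ** (c1 ** c2 ** c3)) =
    corner_emb (b1 ** b2) ** corner_emb (b3 ** c1 ** c2 ** c3).
  rewrite -corner_embM (corner_emb_elt (homogM _ _ _ _ hl hr)).
  by rewrite !amulA.
by apply: mem_mulset; [exists (b1 ** b2) | exists (b3 ** c1 ** c2 ** c3)].
Qed.

(** b1 b2 is in B_t = B_t B_{t^-1} B_t, whose first two factors are split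
    off to the left as corner elements. *)
Lemma row1_unital t : X_ t `<=` P t `** P t^-1%g `** X_ t.
Proof.
have lX := mulset_linear (P t `** P t^-1%g) (X_ t).
move=> f [f1 hf]; apply: (homog_elt_ind lX hf) => r u.
have [->|r1] := eqVneq r 1%g; last by rewrite f1 ?eqxx.
move=> _ b1 b2 b3 h1 h2 h3.
pose T := entry t 1%g u `&`
  [set b | (P t `** P t^-1%g `** X_ t) (elt t 1%g u b)].
suff [] : T (b1 ** b2 ** b3) by [].
have : B_ t (b1 ** b2).
  by rewrite -[t]mul1g; apply: homogM => //; rewrite -invg1.
have lT := linear_rmul b3 (elt_preimage_linear t 1%g u lX).
rewrite {1}B_psg; apply: (mulset_sub lT) => c d hc hd.
move: c hc; apply: (mulset_sub (linear_rmul d lT)) => c1 c2 k1 k2.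
have hdb : entry t 1%g u (d ** b3) by rewrite entry_row1; apply: mem_mulset.
have cE : elt t 1%g u (c1 ** c2 ** d ** b3) =
    corner_emb c1 ** corner_emb c2 ** elt t 1%g u (d ** b3).
  rewrite -corner_embM (corner_emb_elt (homogM _ _ _ _ k1 k2)).
  rewrite eltM ?eqxx ?entry11 //; last exact: homogM.
  by rewrite mulgV mul1g amulA.
split.
  rewrite /mkset entry_row1; apply: mem_mulset => //.
  by rewrite -[t]mul1g -(mulgV t); do 2?apply: homogM.
rewrite /mkset cE; apply: mem_mulset.
  by apply: mem_mulset; [exists c1 | exists c2].
by split; [exact: elt_row1 | exact: elt_homog].
Qed.

(** Mirror image of [row1_unital]: b2 b3 is in B_t (B_{t^-1} B_t). *)
Lemma col1_unital t : Y_ t `<=` Y_ t `** (P t^-1%g `** P t).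
Proof.
have lY := mulset_linear (Y_ t) (P t^-1%g `** P t).
move=> f [f1 hf]; apply: (homog_elt_ind lY hf) => r u.
have [->|u1] := eqVneq u 1%g; last first.
  rewrite f1 ?eqxx //; apply: contraNneq u1 => tu.
  by apply/eqP/(mulgI t); rewrite mulg1.
move=> _ b1 b2 b3 h1 h2 h3.
pose T := entry t r 1%g `&`
  [set b | (Y_ t `** (P t^-1%g `** P t)) (elt t r 1%g b)].
suff [] : T (b1 ** (b2 ** b3)) by rewrite amulA.
have : B_ t (b2 ** b3) by rewrite -[t]mulg1; apply: homogM.
have lT := linear_lmul b1 (elt_preimage_linear t r 1%g lY).
rewrite {1}B_psg -mulsetA; apply: (mulset_sub lT) => d c hd hc.
move: c hc; apply: (mulset_sub (linear_lmul d lT)) => c1 c2 k1 k2.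
have hbd : entry t r 1%g (b1 ** d) by rewrite entry_col1; apply: mem_mulset.
have cE : elt t r 1%g (b1 ** (d ** (c1 ** c2))) =
    elt t r 1%g (b1 ** d) ** (corner_emb c1 ** corner_emb c2).
  rewrite -corner_embM (corner_emb_elt (homogM _ _ _ _ k1 k2)).
  rewrite eltM ?eqxx ?entry11 //; last exact: homogM.
  by rewrite mulVg mulg1 amulA.
split.
  rewrite /mkset entry_col1; apply: mem_mulset => //.
  by rewrite -[t]mulg1 -(mulVg t); do 2?apply: homogM.
rewrite /mkset cE; apply: mem_mulset.
  by split; [exact: elt_col1 | exact: elt_homog].
by apply: mem_mulset; [exists c1 | exists c2].
Qed.

(** b1 b2 b3 at (r,u) in degree t is b1 at (r,1) in degree 1 times b2 b3 at
    (1,u) in degree t. *)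
Lemma corner_is_full : [set: C] `<=` col1 `** row1.
Proof.
move=> f _; have lYX := mulset_linear col1 row1.
apply: homog_ind => // t; have [_ /(_ t) hf _] := hcompP f.
apply: (homog_elt_ind lYX hf) => r u _ b1 b2 b3 h1 h2 h3.
have hl : entry 1%g r 1%g b1 by rewrite entry_col1 homog_mulset1r.
have hr : entry t 1%g u (b2 ** b3) by rewrite entry_row1; apply: mem_mulset.
have -> : elt t r u (b1 ** b2 ** b3) =
    elt 1%g r 1%g b1 ** elt t 1%g u (b2 ** b3).
  by rewrite eltM // eqxx mul1g amulA.
by apply: mem_mulset; [exact: elt_col1 | exact: elt_row1].
Qed.

End SkewMatrices.

Theorem theorem7p10 (k : comPzRingType) (G : groupType)
    (B : gradedAlgType k G) :
  partially_strongly_graded B ->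
  strongly_graded_equivalent B (partial_skew_algebra B).
Proof.
move=> B_psg.
apply: (@corner_equivalence _ _ _ _ (corner_emb B_psg)
  (@row1 _ _ B) (@col1 _ _ B)).
- exact: B_psg.
- exact: corner_embM.
- exact: corner_emb_inj.
- exact: corner_emb_homog.
- exact: row1_linear.
- exact: col1_linear.
- exact: row1_comp.
- exact: col1_comp.
- exact: row1_ideal.
- exact: col1_ideal.
- exact: range_corner_emb.
- exact: skew_Dideal_sub.
- exact: row1_mul_col1.
- exact: row1_unital.
- exact: col1_unital.
- exact: corner_is_full.
Qed.
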